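(* There is a quantum algorithm that evaluates a NAND-AND-OR-NOT DAG, and one that evaluates a NAND-NOT DAG. For such a DAG $G=(V,E)$, these algorithms work with running time $O(\sqrt{\hat{n}m\log\hat{n}})=O(\sqrt{nm\log n})$ and error probability $O(1/\hat{n})$, where $m=|E|$, $n=|V|$, $\hat{n}=n-|L|$ and $L$ is the set of sinks.
   Context: Such DAGs are directed acyclic graphs $G=(V,E)$, $V=\{v_1,\dots,v_n\}$, given in the adjacency list model (arrays $D_i$ of out-neighbours of $v_i$, $d_i=|D_i|$), topologically sorted (each edge $(v_i,v_j)$ has $i<j$) with sinks being the last $|L|$ vertices, such that: each sink is labeled with a Boolean variable; there is no vertex with $d_i=1$; each vertex with $d_i\ge2$ is a function-vertex labeled with a function $h_i$, where $h_i\in\{NAND,AND,OR\}$ for a NAND-AND-OR-NOT DAG and $h_i=NAND$ for a NAND-NOT DAG; each edge $(v_i,v_j)$ is labeled with $\sigma(i,j)\in\{0,1\}$; and there is one designated root $v_s$. Values: $r_i$ is the variable's value at a sink; at a function-vertex $r_i=h_i(r_{j_1}^{\sigma(i,j_1)},\dots,r_{j_w}^{\sigma(i,j_w)})$ with $(v_{j_1},\dots,v_{j_w})=D_i$, $x^1=x$, $x^0=\neg x$; $NAND(y_1,\dots,y_w)=\neg(y_1\wedge\dots\wedge y_w)$. Evaluating means computing $r_s$. Query model: running time is the number of oracle queries to the graph, labels and variable values. *)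

(* Defs.v *)
From HB Require Import structures.
From mathcomp Require Import all_boot all_order all_algebra.
From mathcomp Require Import complex.
From mathcomp Require Import reals exp.

Set Implicit Arguments.
Unset Strict Implicit.
Unset Printing Implicit Defensive.

Import Order.TTheory GRing.Theory Num.Theory.
Local Open Scope ring_scope.

Inductive gate := NAND | AND | OR.

Definition gate_eval (h : gate) (ys : seq bool) : bool :=
  match h with
  | NAND => ~~ all id ys
  | AND => all id ys
  | OR => has id ys
  end.

(* 0-based: v_1, ..., v_n are the elements of 'I_n.  The fields dag_gate (on
   sinks), dag_var (on function-vertices) and dag_sgn (on non-edges) carry
   irrelevant values where the label does not exist. *)
Record dag (n K : nat) := Dag {
  dag_adj : 'I_n -> seq 'I_n;
  dag_gate : 'I_n -> gate;
  dag_sgn : 'I_n -> 'I_n -> bool;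
  dag_var : 'I_n -> 'I_K;
  dag_root : 'I_n
}.

Section Dag.
Variables (n K : nat) (G : dag n K).

Definition edges : {set 'I_n * 'I_n} := [set e | e.2 \in dag_adj G e.1].

Definition sinks : {set 'I_n} := [set i | size (dag_adj G i) == 0%N].

Definition nhat : nat := (n - #|sinks|)%N.

Definition nand_and_or_not_dag : Prop :=
  [/\ forall i, uniq (dag_adj G i),
      forall i j, (i, j) \in edges -> (i < j)%N,
      forall i, (i \in sinks) = (nhat <= i)%N
    & forall i, size (dag_adj G i) != 1%N].

Definition nand_not_dag : Prop :=
  nand_and_or_not_dag /\ forall i, i \notin sinks -> dag_gate G i = NAND.

Variable x : 'I_K -> bool.

Definition literal (y s : bool) : bool := if s then y else ~~ y.

(* The first argument bounds the recursion depth; depth n is enough because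
   edges increase the index, see value_sink and value_gate. *)
Fixpoint value_rec (k : nat) (i : 'I_n) : bool :=
  if k is k'.+1 then
    if i \in sinks then x (dag_var G i)
    else gate_eval (dag_gate G i)
           [seq literal (value_rec k' j) (dag_sgn G i j) | j <- dag_adj G i]
  else false.

Definition value (i : 'I_n) : bool := value_rec n i.

Lemma value_recE (k : nat) (i : 'I_n) : nand_and_or_not_dag ->
  (n - i <= k)%N -> value_rec k i = value_rec n i.
Proof.
move=> [_ lt_edge _ _]; move: k i.
suff main l k (i : 'I_n) : (n - i <= k)%N -> (n - i <= l)%N ->
    value_rec k i = value_rec l i.
  by move=> k i le_k; apply: main => //; exact: leq_subr.
elim: l k i => [|l IHl] [|k] i //; rewrite ?leqn0 ?subn_eq0 ?(leqNgt n) ?ltn_ord //.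
move=> le_k le_l /=; case: ifP => // _; congr gate_eval.
apply/eq_in_map => j ij; congr literal.
have lt_ij : (i < j)%N by apply: lt_edge; rewrite inE.
have lt_n := ltn_sub2l (ltn_ord i) lt_ij.
by apply: IHl; rewrite -ltnS (leq_trans lt_n).
Qed.

Lemma value_sink (i : 'I_n) : nand_and_or_not_dag ->
  i \in sinks -> value i = x (dag_var G i).
Proof.
move=> wf si; rewrite /value -(@value_recE n.+1 i) ?leqW ?leq_subr //=.
by rewrite si.
Qed.

Lemma value_gate (i : 'I_n) : nand_and_or_not_dag -> i \notin sinks ->
  value i = gate_eval (dag_gate G i)
              [seq literal (value j) (dag_sgn G i j) | j <- dag_adj G i].
Proof.
move=> wf si; rewrite {1}/value -(@value_recE n.+1 i) ?leqW ?leq_subr //=.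
by rewrite (negbTE si).
Qed.

End Dag.

(* Each constructor application is one possible oracle query; QNbr i p asks for
   the entry at position p of the array D_i, QSgn i j for sigma(i,j). *)
Inductive query (n K : nat) :=
| QRoot
| QDeg of 'I_n
| QNbr of 'I_n & 'I_n
| QGate of 'I_n
| QSgn of 'I_n & 'I_n
| QVar of 'I_n
| QVal of 'I_K.
Arguments QRoot {n K}.
Arguments QDeg {n K}.
Arguments QNbr {n K}.
Arguments QGate {n K}.
Arguments QSgn {n K}.
Arguments QVar {n K}.
Arguments QVal {n K}.

Section QueryFin.
Variables (n K : nat).

Definition query_code (q : query n K) :
    unit + 'I_n + 'I_n * 'I_n + 'I_n + 'I_n * 'I_n + 'I_n + 'I_K :=
  match q with
  | QRoot => inl (inl (inl (inl (inl (inl tt)))))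
  | QDeg i => inl (inl (inl (inl (inl (inr i)))))
  | QNbr i p => inl (inl (inl (inl (inr (i, p)))))
  | QGate i => inl (inl (inl (inr i)))
  | QSgn i j => inl (inl (inr (i, j)))
  | QVar i => inl (inr i)
  | QVal k => inr k
  end.

Definition query_decode
    (c : unit + 'I_n + 'I_n * 'I_n + 'I_n + 'I_n * 'I_n + 'I_n + 'I_K) :
    query n K :=
  match c with
  | inl (inl (inl (inl (inl (inl _))))) => QRoot
  | inl (inl (inl (inl (inl (inr i))))) => QDeg i
  | inl (inl (inl (inl (inr (i, p))))) => QNbr i p
  | inl (inl (inl (inr i))) => QGate i
  | inl (inl (inr (i, j))) => QSgn i j
  | inl (inr i) => QVar i
  | inr k => QVal k
  end.

Lemma query_codeK : cancel query_code query_decode.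
Proof. by case. Qed.

End QueryFin.

HB.instance Definition _ (n K : nat) :=
  Finite.copy (query n K) (can_type (@query_codeK n K)).

Definition gate_code (h : gate) : nat :=
  match h with NAND => 0 | AND => 1 | OR => 2 end.

(* The answer register holds integers modulo n + K + 3; every answer below is
   at most n + K + 2, so inord loses no information. *)
Definition answer (n K : nat) := 'I_(n + K + 2).+1.

Definition dag_oracle (n K : nat) (G : dag n K) (x : 'I_K -> bool)
    (q : query n K) : answer n K :=
  inord match q with
        | QRoot => val (dag_root G)
        | QDeg i => size (dag_adj G i)
        | QNbr i p => nth 0%N (map val (dag_adj G i)) p
        | QGate i => gate_code (dag_gate G i)
        | QSgn i j => nat_of_bool (dag_sgn G i j)
        | QVar i => val (dag_var G i)
        | QVal k => nat_of_bool (x k)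
        end.

(* Quantum query algorithms with intermediate measurements.  The computational
   basis is Q * A * W: query register, answer register, workspace; states are
   column vectors indexed by the enumeration of that basis, and are not
   renormalised after a measurement. *)
Section Quantum.
Variables (R : realType) (Q : finType) (A : finZmodType).

Definition basis (W : finType) : finType := (Q * A * W)%type.

Definition qstate (W : finType) := 'cV[R[i]]_#|basis W|.

Inductive qprog (W : finType) : Type :=
| Halt of bool
| Apply (U : 'M[R[i]]_#|basis W|) of U \is unitarymx & qprog W
| Query of qprog W
| Measure (T : finType) (obs : basis W -> T) of (T -> qprog W).

Record qalg := QAlg {
  qwork : finType;
  qstart : basis qwork;
  qbody : qprog qwork
}.

Variable f : Q -> A.

(* |q, a, w> |-> |q, a + f q, w> *)
Definition query_state (W : finType) (psi : qstate W) : qstate W :=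
  \col_k let: (q, a, w) := enum_val k in psi (enum_rank (q, a - f q, w)) 0.

Definition project (W T : finType) (obs : basis W -> T) (o : T)
    (psi : qstate W) : qstate W :=
  \col_k if obs (enum_val k) == o then psi k 0 else 0.

Definition basis_state (W : finType) (b : basis W) : qstate W :=
  delta_mx (enum_rank b) 0.

Definition normsq (W : finType) (psi : qstate W) : R :=
  \sum_k (complex.Re (psi k 0) ^+ 2 + complex.Im (psi k 0) ^+ 2).

Fixpoint prog_prob (W : finType) (p : qprog W) (psi : qstate W) (b : bool) : R :=
  match p with
  | Halt b' => if b' == b then normsq psi else 0
  | Apply U _ p' => prog_prob p' (U *m psi) b
  | Query p' => prog_prob p' (query_state psi) b
  | Measure T obs k => \sum_(o : T) prog_prob (k o) (project obs o psi) b
  end.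

(* Largest number of queries over all measurement outcomes of nonzero
   probability. *)
Fixpoint prog_queries (W : finType) (p : qprog W) (psi : qstate W) : nat :=
  match p with
  | Halt _ => 0%N
  | Apply U _ p' => prog_queries p' (U *m psi)
  | Query p' => (prog_queries p' (query_state psi)).+1
  | Measure T obs k =>
      (\max_(o : T | project obs o psi != 0%R)
         prog_queries (k o) (project obs o psi))%N
  end.

Definition output_prob (P : qalg) (b : bool) : R :=
  prog_prob (qbody P) (basis_state (qstart P)) b.

Definition num_queries (P : qalg) : nat :=
  prog_queries (qbody P) (basis_state (qstart P)).

End Quantum.

(* A family of algorithms that receives only n and the number K of variables;
   everything else about the instance is obtained through queries. *)
Definition dag_algorithm (R : realType) :=
  forall n K : nat, qalg R (query n K) (answer n K).

Definition running_time (R : realType) (P : dag_algorithm R) (n K : nat)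
    (G : dag n K) (x : 'I_K -> bool) : R :=
  (num_queries (dag_oracle G x) (P n K))%:R.

Definition error_prob (R : realType) (P : dag_algorithm R) (n K : nat)
    (G : dag n K) (x : 'I_K -> bool) : R :=
  output_prob (dag_oracle G x) (P n K) (~~ value G x (dag_root G)).

Definition evaluates_within (R : realType) (P : dag_algorithm R)
    (cls : forall n K : nat, dag n K -> Prop) (C c : R) : Prop :=
  forall (n K : nat) (G : dag n K) (x : 'I_K -> bool),
    cls n K G -> (0 < nhat G)%N ->
    [/\ (1 < nhat G)%N ->
          running_time P G x <=
          C * Num.sqrt ((nhat G)%:R * #|edges G|%:R * ln (nhat G)%:R),
        running_time P G x <= C * Num.sqrt (n%:R * #|edges G|%:R * ln n%:R)
      & error_prob P G x <= c / (nhat G)%:R].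

(* Main.v *)
(* Vertices are evaluated in reverse topological order, the function-vertex v_i by a
   quantum search over its d_i inputs for one that decides the gate.  A search of d
   items with error 2^-T takes O(sqrt(d T)) queries (Buhrman, Cleve, de Wolf, Zalka):
   first, for every s <= T, amplitude amplification tuned to succeed with certainty
   if there are exactly s solutions, at cost O(sqrt(d/s)); then, for the case of more
   than T solutions, T repetitions of amplitude amplification with rotation angles
   theta, 3 theta, 9 theta, ..., one of which falls into [pi/4, 3 pi/4].  With
   T ~ 2 log nhat the errors add up to at most 1/nhat, and the costs to
   sqrt(T) sum_i sqrt(d_i) <= sqrt(T nhat m) by Cauchy-Schwarz. *)

From mathcomp Require Import all_boot all_order all_fingroup all_algebra.
From mathcomp Require Import complex.
From mathcomp Require Import topology normedtype derive.
From mathcomp Require Import reals exp trigo.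
From mathcomp Require Import ring lra zify.
Require Import Defs.

Set Implicit Arguments.
Unset Strict Implicit.
Unset Printing Implicit Defensive.

Import Order.TTheory GRing.Theory Num.Theory numFieldNormedType.Exports.
Local Open Scope ring_scope.
Local Open Scope complex_scope.

(** * Real amplitudes *)

(** Programs mix linear algebra with adaptive control flow. The two are separated here: all
    amplitudes used are real, and every measurement reads the full basis state and resets it. A
    program then behaves like a classical decision tree whose nodes are single queries and
    amplification runs; a run of [k] rounds on good weight [p] succeeds with probability exactly
    [sin ((2 * k + 1) * asin (sqrt p)) ^ 2]. A run is tuned to [s] solutions by lowering the weight
    of each item, not by altering a phase: a dummy item absorbs the lost amplitude. The value of an
    input is hidden behind dependent queries: neighbour, edge sign and, for a sink, its variable and
    that variable's value. A reversible circuit of four queries looks it up in superposition;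
    vertices already evaluated enter through a classically fixed predicate, at no query. A found
    item is always a genuine solution, so only searches that have a solution can err. *)

Section RealAmplitudes.
Variables (R : realType) (Q : finType) (A : finZmodType) (W : finType).
Local Notation B := (basis Q A W).

Definition vec (phi : B -> R) : qstate R Q A W := \col_k (phi (enum_val k))%:C.

Definition mx (F : B -> B -> R) : 'M[R[i]]_#|B| :=
  \matrix_(k, l) (F (enum_val k) (enum_val l))%:C.

Definition ket (b : B) : B -> R := fun b' => (b' == b)%:R.

Lemma eq_vec (phi psi : B -> R) : phi =1 psi -> vec phi = vec psi.
Proof. by move=> e; apply/colP => k; rewrite !mxE e. Qed.

Lemma vec_basis_state (b : B) : basis_state R b = vec (ket b).
Proof.
apply/colP => k; rewrite !mxE /ket eqxx andbT -(inj_eq enum_val_inj) enum_rankK.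
by rewrite rmorph_nat.
Qed.

Lemma sum_enum_val (V : nmodType) (F : B -> V) :
  \sum_(k < #|B|) F (enum_val k) = \sum_b F b.
Proof.
rewrite (reindex (@enum_rank B)) /=; last by apply: onW_bij; exact: enum_rank_bij.
by apply: eq_bigr => b _; rewrite enum_rankK.
Qed.

Lemma normsq_vec (phi : B -> R) : normsq (vec phi) = \sum_b phi b ^+ 2.
Proof.
rewrite /normsq -(sum_enum_val (fun b => phi b ^+ 2)).
by apply: eq_bigr => k _; rewrite mxE /= expr0n addr0.
Qed.

Lemma mul_mx_vec (F : B -> B -> R) (phi : B -> R) :
  mx F *m vec phi = vec (fun b => \sum_b' F b b' * phi b').
Proof.
apply/colP => k; rewrite !mxE -(sum_enum_val (fun b' => F (enum_val k) b' * phi b')).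
by rewrite rmorph_sum; apply: eq_bigr => l _; rewrite !mxE rmorphM.
Qed.

Lemma mx_unitary (F : B -> B -> R) :
  (forall b b', \sum_c F b c * F b' c = (b == b')%:R) -> mx F \is unitarymx.
Proof.
have conjE (a : R) : Num.conj a%:C = a%:C by exact: conjc_real.
move=> orth; apply/unitarymxP/matrixP => k l; rewrite !mxE.
under eq_bigr => j _ do rewrite !mxE conjE -rmorphM /=.
rewrite -rmorph_sum (sum_enum_val (fun b => F (enum_val k) b * F (enum_val l) b)).
by rewrite orth (inj_eq enum_val_inj) rmorph_nat.
Qed.


Definition perm_op (s : {perm B}) := mx (fun b b' => (b == s b')%:R).

Lemma perm_op_unitary (s : {perm B}) : perm_op s \is unitarymx.
Proof.
apply: mx_unitary => b b'; rewrite (bigD1 ((s^-1)%g b)) //= permKV eqxx mul1r.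
rewrite (eq_sym b') big1 ?addr0 // => c.
by case: (b =P s c) => [->|_]; rewrite ?permK ?eqxx // mul0r.
Qed.

Lemma perm_op_vec (s : {perm B}) (phi : B -> R) :
  perm_op s *m vec phi = vec (fun b => phi ((s^-1)%g b)).
Proof.
rewrite mul_mx_vec; apply: eq_vec => b.
rewrite (bigD1 ((s^-1)%g b)) //= permKV eqxx mul1r big1 ?addr0 // => c.
by case: (b =P s c) => [->|_]; rewrite ?permK ?eqxx // mul0r.
Qed.

(** The sign falls on the unmarked states, not on the marked ones: composed with the reflection
    [1 - 2 s s^T], this is the Grover iterate without an extra global minus sign. *)
Definition sign_op (m : pred B) :=
  mx (fun b b' => (b == b')%:R * (-1) ^+ (~~ m b)).

Lemma sign_op_vec (m : pred B) (phi : B -> R) :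
  sign_op m *m vec phi = vec (fun b => (-1) ^+ (~~ m b) * phi b).
Proof.
rewrite mul_mx_vec; apply: eq_vec => b; rewrite (bigD1 b) //= eqxx mul1r.
by rewrite big1 ?addr0 // => c; rewrite eq_sym => /negbTE ->; rewrite !mul0r.
Qed.

Lemma sign_op_unitary (m : pred B) : sign_op m \is unitarymx.
Proof.
apply: mx_unitary => b b'; rewrite (bigD1 b) //= eqxx mul1r big1 => [|c].
  rewrite addr0 mulrCA eq_sym; case: eqP => [->|_]; last by rewrite mul0r.
  by rewrite mul1r -expr2 sqrr_sign.
by rewrite eq_sym => /negbTE ->; rewrite !mul0r.
Qed.

(* For v = 0 the division gives 0 and the operator is the identity. *)
Definition householder (v : B -> R) :=
  mx (fun b b' => (b == b')%:R - 2 / (\sum_c v c ^+ 2) * v b * v b').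

Lemma sum_ket (b : B) (F : B -> R) : \sum_c (b == c)%:R * F c = F b.
Proof.
rewrite (bigD1 b) //= eqxx mul1r big1 ?addr0 // => c.
by rewrite eq_sym => /negbTE ->; rewrite mul0r.
Qed.

Lemma householder_vec (v phi : B -> R) :
  householder v *m vec phi =
  vec (fun b => phi b - 2 / (\sum_c v c ^+ 2) * (\sum_c v c * phi c) * v b).
Proof.
rewrite mul_mx_vec; apply: eq_vec => b.
under eq_bigr => c _ do rewrite mulrBl.
rewrite sumrB sum_ket; congr (_ - _).
rewrite mulr_sumr mulr_suml; apply: eq_bigr => c _; ring.
Qed.

Lemma householder_unitary (v : B -> R) : householder v \is unitarymx.
Proof.
apply: mx_unitary => b b'; set N := \sum_c v c ^+ 2.
have -> : \sum_c ((b == c)%:R - 2 / N * v b * v c) *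
                 ((b' == c)%:R - 2 / N * v b' * v c) =
  (b' == b)%:R - 4 / N * v b * v b' + (2 / N) ^+ 2 * v b * v b' * N.
  rewrite (eq_bigr (fun c => (b == c)%:R * ((b' == c)%:R - 2 / N * v b' * v c)
      - (b' == c)%:R * (2 / N * v b * v c)
      + (2 / N) ^+ 2 * v b * v b' * v c ^+ 2)) => [|c _]; last by ring.
  rewrite big_split sumrB !sum_ket -mulr_sumr -/N /=; ring.
rewrite eq_sym; have [N0|N0] := eqVneq N 0.
  by rewrite N0 invr0; ring.
by field.
Qed.

(** Reflection along the difference of two real unit vectors exchanges them, so one Householder step
    prepares the start state of a search. The factor [c] is the amplitude left by earlier
    measurements, since states are not renormalised. *)
Lemma householder_swap (b0 : B) (s : B -> R) (c : R) : \sum_b s b ^+ 2 = 1 ->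
  householder (fun b => ket b0 b - s b) *m vec (fun b => c * ket b0 b) =
  vec (fun b => c * s b).
Proof.
move=> s1; rewrite householder_vec; apply: eq_vec => b.
have ketE F : \sum_c ket b0 c * F c = F b0.
  by rewrite -[RHS](sum_ket b0); apply: eq_bigr => d _; rewrite /ket eq_sym.
have -> : \sum_d (ket b0 d - s d) ^+ 2 = 2 * (1 - s b0).
  rewrite (eq_bigr (fun d => ket b0 d * (ket b0 d - 2 * s d) + s d ^+ 2)) =>
    [|d _]; last by ring.
  by rewrite big_split ketE s1 /ket eqxx /=; ring.
have -> : \sum_d (ket b0 d - s d) * (c * ket b0 d) = c * (1 - s b0).
  rewrite (eq_bigr (fun d => ket b0 d * (c * (ket b0 d - s d)))) => [|d _];
    last by ring.
  by rewrite ketE /ket eqxx.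
have [e|ne] := eqVneq (s b0) 1; last first.
  by field; rewrite subr_eq0 eq_sym.
(* [s b0 = 1] leaves no norm for the other entries, so [s] is [ket b0] and nothing moves. *)
have {}s1 : \sum_(d | d != b0) s d ^+ 2 = 0.
  by move: s1; rewrite (bigD1 b0) //= e expr1n => /(canRL (addKr _)); rewrite addNr.
have -> : s b = ket b0 b; last by ring.
rewrite /ket; have [-> //|nb] := eqVneq b b0.
move/eqP: s1; rewrite psumr_eq0 => [/allP/(_ b)|d _]; last exact: sqr_ge0.
by rewrite mem_index_enum nb sqrf_eq0 => /(_ isT)/eqP.
Qed.

End RealAmplitudes.

(** * Query circuits and amplitude amplification *)

Section Circuits.
Variables (R : realType) (Q : finType) (A : finZmodType) (W : finType).
Local Notation B := (basis Q A W).
Local Notation prog := (qprog R Q A W).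

(* [None] stands for a query. *)
Definition circuit := seq (option {perm B}).

(** A query can only add [f q]; conjugating it by negation of the answer register subtracts [f q],
    so an inverse query again costs one query. *)
Definition neg_answer (b : B) : B := let: (q, a, w) := b in (q, - a, w).

Lemma neg_answer_inj : injective neg_answer.
Proof. by apply: inv_inj => -[[q a] w]; rewrite /neg_answer opprK. Qed.

Fixpoint run (E : circuit) (p : prog) : prog :=
  match E with
  | [::] => p
  | Some s :: E' => Apply (perm_op_unitary R s) (run E' p)
  | None :: E' => Query (run E' p)
  end.

Fixpoint run_inv (E : circuit) (p : prog) : prog :=
  match E with
  | [::] => p
  | Some s :: E' => run_inv E' (Apply (perm_op_unitary R s^-1%g) p)
  | None :: E' =>
      let neg := perm_op_unitary R (perm neg_answer_inj) in
      run_inv E' (Apply neg (Query (Apply neg p)))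
  end.

Definition circuit_queries (E : circuit) : nat := count (fun g => ~~ isSome g) E.

Variable f : Q -> A.

Definition query_fun (b : B) : B := let: (q, a, w) := b in (q, a + f q, w).

Lemma query_fun_inj : injective query_fun.
Proof.
apply: (can_inj (g := fun b => let: (q, a, w) := b in (q, a - f q, w))).
by move=> [[q a] w]; rewrite /query_fun addrK.
Qed.

Definition query_perm : {perm B} := perm query_fun_inj.

Lemma query_permV (q : Q) (a : A) (w : W) :
  query_perm^-1%g (q, a, w) = (q, a - f q, w).
Proof.
by apply: (@perm_inj _ query_perm); rewrite permKV permE /query_fun subrK.
Qed.

Lemma query_state_vec (phi : B -> R) :
  query_state f (vec phi) = vec (fun b => phi (query_perm^-1%g b)).
Proof.
apply/colP => k; rewrite !mxE; case: (enum_val k) => -[q a] w.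
by rewrite !mxE enum_rankK query_permV.
Qed.

Fixpoint circuit_perm (E : circuit) : {perm B} :=
  match E with
  | [::] => 1%g
  | Some s :: E' => (s * circuit_perm E')%g
  | None :: E' => (query_perm * circuit_perm E')%g
  end.

Lemma prob_run (E : circuit) (p : prog) (phi : B -> R) (b : bool) :
  prog_prob f (run E p) (vec phi) b =
  prog_prob f p (vec (fun c => phi ((circuit_perm E)^-1%g c))) b.
Proof.
elim: E phi => [|[s|] E IH] phi /=.
- by congr prog_prob; apply: eq_vec => c; rewrite invg1 perm1.
- rewrite perm_op_vec IH; congr prog_prob; apply: eq_vec => c.
  by rewrite invMg permM.
- rewrite query_state_vec IH; congr prog_prob; apply: eq_vec => c.
  by rewrite invMg permM.
Qed.

Lemma queries_run (E : circuit) (p : prog) (phi : B -> R) :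
  prog_queries f (run E p) (vec phi) =
  (circuit_queries E +
   prog_queries f p (vec (fun c => phi ((circuit_perm E)^-1%g c))))%N.
Proof.
elim: E phi => [|[s|] E IH] phi /=.
- by congr prog_queries; apply: eq_vec => c; rewrite invg1 perm1.
- rewrite perm_op_vec IH; congr (_ + prog_queries _ _ _)%N.
  by apply: eq_vec => c; rewrite invMg permM.
- rewrite query_state_vec IH /= add1n addSn; congr ((_ + prog_queries _ _ _).+1)%N.
  by apply: eq_vec => c; rewrite invMg permM.
Qed.

Lemma query_inverse (phi : B -> R) :
  let neg := perm_op R (perm neg_answer_inj) in
  neg *m query_state f (neg *m vec phi) = vec (fun c => phi (query_perm c)).
Proof.
have negV : (perm neg_answer_inj)^-1%g =1 neg_answer.
  move=> c; apply: (@perm_inj _ (perm neg_answer_inj)); rewrite permKV permE.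
  by case: c => -[q a] w; rewrite /neg_answer opprK.
move=> neg; rewrite perm_op_vec query_state_vec perm_op_vec; apply: eq_vec => -[[q a] w].
rewrite !negV /= query_permV /= !permE /=; congr (phi (_, _, _)).
by rewrite opprD !opprK.
Qed.

Lemma prob_run_inv (E : circuit) (p : prog) (phi : B -> R) (b : bool) :
  prog_prob f (run_inv E p) (vec phi) b =
  prog_prob f p (vec (fun c => phi (circuit_perm E c))) b.
Proof.
elim: E p => [|[s|] E IH] p.
- by congr prog_prob; apply: eq_vec => c; rewrite perm1.
- rewrite IH /= perm_op_vec; congr prog_prob; apply: eq_vec => c.
  by rewrite invgK permM.
- rewrite IH /= query_inverse; congr prog_prob; apply: eq_vec => c.
  by rewrite permM.
Qed.

Lemma queries_run_inv (E : circuit) (p : prog) (phi : B -> R) :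
  prog_queries f (run_inv E p) (vec phi) =
  (circuit_queries E +
   prog_queries f p (vec (fun c => phi (circuit_perm E c))))%N.
Proof.
elim: E p => [|[s|] E IH] p.
- by congr prog_queries; apply: eq_vec => c; rewrite perm1.
- rewrite IH /= perm_op_vec; congr (_ + prog_queries _ _ _)%N.
  by apply: eq_vec => c; rewrite invgK permM.
- rewrite IH /= query_inverse add1n addSnnS; congr (_ + (prog_queries _ _ _).+1)%N.
  by apply: eq_vec => c; rewrite permM.
Qed.

End Circuits.

(** * Decision trees as a model of programs *)

Section Trees.
Variables (R : realType) (Q : finType) (A : finZmodType) (W : finType).
Local Notation B := (basis Q A W).
Local Notation prog := (qprog R Q A W).
Local Notation circuit := (circuit Q A W).

Record unit_vector := UnitVector {
  uval :> B -> R;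
  unit_vectorP : \sum_b uval b ^+ 2 = 1
}.

(* Classically controlled algorithms: [Amp s k E m] runs [k] rounds of amplitude
   amplification from the state [s], where a basis state is good if the circuit
   [E] maps it into [m]; its outcome tells whether a good state was observed. *)
Inductive tree :=
| Leaf of bool
| Ask of Q & (A -> tree)
| Amp of unit_vector & nat & circuit & pred B & (bool -> tree).

Fixpoint rounds (s : B -> R) (k : nat) (E : circuit) (m : pred B) (p : prog) : prog :=
  if k is k'.+1 then
    run E (Apply (sign_op_unitary R m)
      (run_inv E (Apply (householder_unitary s) (rounds s k' E m p))))
  else p.

Variables (q0 : Q) (w0 : W).
Let b0 : B := (q0, 0, w0).

(** The outcome [b] of a complete measurement is known classically, so the transposition of [b] and
    [b0] resets the register. Every continuation thus starts from a multiple of [ket b0]. *)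
Fixpoint compile (t : tree) : prog :=
  match t with
  | Leaf b => Halt _ _ _ _ b
  | Ask q k =>
      Apply (perm_op_unitary R (tperm b0 (q, 0, w0))) (Query
        (Measure (fun b : B => b)
          (fun b => Apply (perm_op_unitary R (tperm b b0)) (compile (k b.1.2)))))
  | Amp s k E m c =>
      Apply (householder_unitary (fun b => ket R b0 b - s b))
        (rounds s k E m (run E
          (Measure (fun b : B => b)
            (fun b => Apply (perm_op_unitary R (tperm b b0)) (compile (c (m b)))))))
  end.

Variable f : Q -> A.

Definition good_weight (s : B -> R) (E : circuit) (m : pred B) : R :=
  \sum_(b | m (circuit_perm f E b)) s b ^+ 2.

Definition amp_angle (k : nat) (p : R) : R := (2 * k + 1)%:R * asin (Num.sqrt p).

Fixpoint tree_prob (t : tree) (b : bool) : R :=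
  match t with
  | Leaf b' => (b' == b)%:R
  | Ask q k => tree_prob (k (f q)) b
  | Amp s k E m c =>
      let a := amp_angle k (good_weight s E m) in
      sin a ^+ 2 * tree_prob (c true) b + cos a ^+ 2 * tree_prob (c false) b
  end.

Fixpoint tree_queries (t : tree) : nat :=
  match t with
  | Leaf _ => 0
  | Ask q k => (tree_queries (k (f q))).+1
  | Amp s k E m c =>
      (2 * k + 1) * circuit_queries E + maxn (tree_queries (c true)) (tree_queries (c false))
  end%N.

(** The plane in which amplification takes place, in coordinates that multiply [s] itself rather
    than its normalised good and bad parts. Nothing is divided by [p] or [1 - p], so the weights 0
    and 1 need no separate case. *)
Definition two_level (s : B -> R) (E : circuit) (m : pred B) (ab : R * R) (b : B) : R :=
  (if m (circuit_perm f E b) then ab.1 else ab.2) * s b.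

Definition round_step (p : R) (ab : R * R) : R * R :=
  (ab.1 * (1 - 2 * p) + 2 * ab.2 * (1 - p), ab.2 * (1 - 2 * p) - 2 * ab.1 * p).

Lemma round_vec (s : unit_vector) (E : circuit) (m : pred B) (ab : R * R) :
  householder s *m vec (fun c => (-1) ^+ (~~ m (circuit_perm f E c)) * two_level s E m ab c) =
  vec (two_level s E m (round_step (good_weight s E m) ab)).
Proof.
rewrite householder_vec unit_vectorP divr1; apply: eq_vec => b.
set p := good_weight _ _ _.
have -> : \sum_c s c * ((-1) ^+ (~~ m (circuit_perm f E c)) * two_level s E m ab c) =
          ab.1 * p - ab.2 * (1 - p).
  have := unit_vectorP s; rewrite (bigID (fun c => m (circuit_perm f E c))) /=.
  rewrite -/(good_weight s E m) -/p => /(canRL (addKr _)) e.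
  rewrite (bigID (fun c => m (circuit_perm f E c))) /= addrC [1 - p]addrC -e /two_level.
  rewrite addrC -mulrN -sumrN !mulr_sumr; congr (_ + _); apply: eq_bigr => c.
    by move=> ->; ring.
  by move=> /negbTE ->; ring.
rewrite /two_level /round_step; case: ifP => _ /=; ring.
Qed.

Lemma prob_rounds (s : unit_vector) (k : nat) (E : circuit) (m : pred B) (p : prog)
    (ab : R * R) (b : bool) :
  prog_prob f (rounds s k E m p) (vec (two_level s E m ab)) b =
  prog_prob f p (vec (two_level s E m (iter k (round_step (good_weight s E m)) ab))) b.
Proof.
elim: k ab => [//|k IH] ab; rewrite iterSr -IH /= prob_run /= sign_op_vec prob_run_inv /=.
by under eq_vec => c do rewrite permK; rewrite round_vec.
Qed.

Lemma queries_rounds (s : unit_vector) (k : nat) (E : circuit) (m : pred B) (p : prog)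
    (ab : R * R) :
  prog_queries f (rounds s k E m p) (vec (two_level s E m ab)) =
  (2 * k * circuit_queries E + prog_queries f p
    (vec (two_level s E m (iter k (round_step (good_weight s E m)) ab))))%N.
Proof.
elim: k ab => [//|k IH] ab; rewrite iterSr /= queries_run /= sign_op_vec queries_run_inv /=.
under eq_vec => c do rewrite permK; rewrite round_vec IH.
by rewrite !addnA; congr addn; ring.
Qed.

(** In the coordinates [ab.1 * sin t] and [ab.2 * cos t], where [sin t ^+ 2 = p], a round is the
    rotation by [2 * t], and the start [(c, c)] sits at angle [t]. *)
Lemma round_angle (p : R) (k : nat) (c : R) : 0 <= p <= 1 ->
  let ab := iter k (round_step p) (c, c) in
  ab.1 ^+ 2 * p = c ^+ 2 * sin (amp_angle k p) ^+ 2 /\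
  ab.2 ^+ 2 * (1 - p) = c ^+ 2 * cos (amp_angle k p) ^+ 2.
Proof.
move=> /andP[p0 p1] ab; rewrite /amp_angle; set t := asin _.
have sp1 : -1 <= Num.sqrt p <= 1.
  by rewrite (le_trans _ (sqrtr_ge0 _)) ?lerN10 //= -sqrtr1 ler_sqrt.
have sE : sin t = Num.sqrt p by rewrite asinK // in_itv.
have s2 : sin t ^+ 2 = p by rewrite sE sqr_sqrtr.
have c2 : cos t ^+ 2 = 1 - p by rewrite cos2sin2 s2.
suff [e1 e2] : ab.1 * sin t = c * sin ((2 * k + 1)%:R * t) /\
               ab.2 * cos t = c * cos ((2 * k + 1)%:R * t).
  by rewrite -[X in _ * X = _ /\ _]s2 -[X in _ /\ _ * X = _]c2 -!exprMn e1 e2.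
rewrite {}/ab; elim: k => [|k [IH1 IH2]]; first by rewrite muln0 add0n mul1r.
have -> : (2 * k.+1 + 1)%:R * t = (2 * k + 1)%:R * t + (t + t).
  by rewrite mulnS -addnA addnC natrD; ring.
rewrite iterS /round_step /=; move: (iter _ _ _) IH1 IH2 => [a b] /= IH1 IH2.
have c2t : cos (t + t) = 1 - 2 * p by rewrite cosD -!expr2 c2 s2; ring.
rewrite (sinD _ (t + t)) (cosD _ (t + t)) c2t (sinD t t).
move: ((2 * k + 1)%:R * t) IH1 IH2 => x IH1 IH2; split.
  have -> : c * (sin x * (1 - 2 * p) + cos x * (sin t * cos t + cos t * sin t)) =
    (c * sin x) * (1 - 2 * p) + (c * cos x) * (2 * sin t * cos t) by ring.
  by rewrite -IH1 -IH2 -c2; ring.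
have -> : c * (cos x * (1 - 2 * p) - sin x * (sin t * cos t + cos t * sin t)) =
  (c * cos x) * (1 - 2 * p) - (c * sin x) * (2 * sin t * cos t) by ring.
by rewrite -IH1 -IH2 -s2; ring.
Qed.

Lemma project_vec (phi : B -> R) (b : B) :
  project (fun c : B => c) b (vec phi) = vec (fun c => phi b * ket R b c).
Proof.
apply/colP => k; rewrite !mxE /ket; case: eqP => [->|_]; first by rewrite mulr1.
by rewrite mulr0.
Qed.

Lemma reset_vec (b : B) (c : R) :
  perm_op R (tperm b b0) *m vec (fun d => c * ket R b d) = vec (fun d => c * ket R b0 d).
Proof.
rewrite perm_op_vec; apply: eq_vec => d; rewrite tpermV /ket.
by rewrite (can2_eq (tpermK _ _) (tpermK _ _)) tpermL.
Qed.

Lemma ask_vec (q : Q) (c : R) :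
  query_state f (perm_op R (tperm b0 (q, 0, w0)) *m vec (fun d => c * ket R b0 d)) =
  vec (fun d => c * ket R (q, f q, w0) d).
Proof.
rewrite perm_op_vec query_state_vec; apply: eq_vec => d; rewrite tpermV /ket.
rewrite (can2_eq (tpermK _ _) (tpermK _ _)) tpermL.
by rewrite (can2_eq (permKV _) (permK _)) permE /query_fun add0r.
Qed.

Lemma good_weight_itv (s : unit_vector) (E : circuit) (m : pred B) :
  0 <= good_weight s E m <= 1.
Proof.
rewrite sumr_ge0 => [|b _]; last exact: sqr_ge0.
rewrite -(unit_vectorP s) [leRHS](bigID (fun c => m (circuit_perm f E c))) /=.
by rewrite lerDl sumr_ge0 // => b _; exact: sqr_ge0.
Qed.

Lemma compile_prob (t : tree) (c : R) (b : bool) :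
  prog_prob f (compile t) (vec (fun d => c * ket R b0 d)) b = c ^+ 2 * tree_prob t b.
Proof.
elim: t c => [b'|q k IH|s k E m t IH] c.
- rewrite /= normsq_vec (bigD1 b0) //= big1 => [|d /negbTE nd].
    by rewrite /ket eqxx mulr1 addr0; case: eqP; rewrite ?mulr1 ?mulr0.
  by rewrite /ket nd mulr0 expr0n.
- rewrite /= ask_vec (bigD1 (q, f q, w0)) //= big1 => [|d /negbTE nd];
    by rewrite project_vec reset_vec IH /ket ?eqxx ?mulr1 ?addr0 // nd mulr0 expr0n mul0r.
rewrite [LHS]/= householder_swap ?unit_vectorP //.
rewrite (@eq_vec _ _ _ _ _ (two_level s E m (c, c))); last first.
  by move=> d; rewrite /two_level /=; case: ifP.
rewrite prob_rounds prob_run /=; set p := good_weight _ _ _.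
have [/= e1 e2] := round_angle k c (good_weight_itv s E m).
move: (iter _ _ _) e1 e2 => ab; rewrite -/p => e1 e2.
under eq_bigr => d _ do rewrite project_vec reset_vec IH.
(* Each outcome is pulled back through the permutation of [E] to the basis state that produced it,
   where the amplitude is that of [two_level]. *)
rewrite (reindex_inj (@perm_inj _ (circuit_perm f E))) /=.
under eq_bigr => d _ do rewrite permK.
rewrite (bigID (fun d => m (circuit_perm f E d))) /=.
rewrite [RHS]mulrDr 2!(mulrA (c ^+ 2)) -e1 -e2; congr (_ + _).
  rewrite /p /good_weight mulr_sumr mulr_suml; apply: eq_bigr => d md.
  by rewrite /two_level md exprMn.
have -> : 1 - p = \sum_(d | ~~ m (circuit_perm f E d)) s d ^+ 2.
  rewrite -(unit_vectorP s) (bigID (fun d => m (circuit_perm f E d))) /=.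
  by rewrite [X in X - _]addrC addrK.
rewrite mulr_sumr mulr_suml; apply: eq_bigr => d /negbTE md.
by rewrite /two_level md exprMn.
Qed.

Lemma compile_queries (t : tree) (c : R) :
  (prog_queries f (compile t) (vec (fun d => c * ket R b0 d)%R) <= tree_queries t)%N.
Proof.
elim: t c => [//|q k IH|s k E m t IH] c.
- rewrite /= ask_vec ltnS; apply/bigmax_leqP => d; rewrite project_vec => nz.
  rewrite reset_vec.
  (* An outcome of nonzero amplitude contains the true answer, so branches for other answers do not
     count. *)
  have <- : d.1.2 = f q; last exact: IH.
  move: nz; rewrite /ket; case: (d =P _) => [-> //|_]; rewrite mulr0 => /eqP[].
  by apply/colP => j; rewrite !mxE mul0r.
rewrite [prog_queries _ _ _]/= householder_swap ?unit_vectorP //.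
rewrite (@eq_vec _ _ _ _ _ (two_level s E m (c, c))); last first.
  by move=> d; rewrite /two_level /=; case: ifP.
rewrite queries_rounds queries_run /= mulnDl mul1n -!addnA !leq_add2l.
apply/bigmax_leqP => d _; rewrite project_vec reset_vec (leq_trans (IH _ _)) //.
by case: (m d); rewrite ?leq_maxl ?leq_maxr.
Qed.

End Trees.

(** * Schedule of a small-error search *)

Section SearchPlan.
Variable R : realType.

Lemma sin_le_id (x : R) : 0 <= x -> sin x <= x.
Proof.
move=> x0; have dsin (y : R) : y \in `]0, x[%R -> is_derive y 1 (@sin R) (cos y).
  by move=> _; exact: is_derive_sin.
have [|c _] := MVT_segment x0 dsin.
  by apply: continuous_subspaceT => y; exact: continuous_sin.
by rewrite sin0 !subr0 => ->; rewrite ler_piMl // cos_le1.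
Qed.

(** On this interval [cos (2 * x)] is nonpositive. *)
Lemma cos2_le_half (x : R) : pi / 4 <= x <= 3 * pi / 4 -> cos x ^+ 2 <= 1 / 2.
Proof.
move=> /andP[x1 x2].
have : 0 <= cos (x *+ 2 - pi) by apply: cos_ge0_pihalf; apply/andP; split; lra.
have := cosDpi (x *+ 2 - pi); rewrite subrK cos_mulr2n => e h.
by move: e h; move: (cos (_ - _)) (cos x ^+ 2) => u v; lra.
Qed.

Lemma cos2_le1 (x : R) : cos x ^+ 2 <= 1.
Proof. by rewrite cos2sin2 lerBlDr lerDl sqr_ge0. Qed.

(** Powers of 3 are odd, so [(3 ^ l)./2] rounds turn an initial angle [t] into exactly
    [3 ^ l * t]. *)
Lemma half_pow3 (l : nat) : (2 * (3 ^ l)./2 + 1 = 3 ^ l)%N.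
Proof.
by rewrite mul2n -[RHS]odd_double_half oddX orbT addnC.
Qed.

(** The first power of 9 above [x %/ s]; for [0 < s <= x], the number [3 ^ level x s] is
    [sqrt (x / s)] up to a factor of 3. *)
Definition level (x s : nat) : nat := up_log 9 (x %/ s).+1.

Lemma level_ge (x s : nat) : (0 < s)%N -> (x <= 9 ^ level x s * s)%N.
Proof.
move=> s0; apply: ltnW; rewrite -ltn_divLR //; exact: up_logP.
Qed.

Lemma level_le (x s : nat) : (0 < s <= x)%N -> (9 ^ level x s * s <= 9 * x)%N.
Proof.
move=> /andP[s0 sx]; have q0 : (0 < x %/ s)%N by rewrite divn_gt0.
have := @up_log_gtn 9 (x %/ s).+1 isT q0; rewrite -/(level x s) ltnS leq_divRL //.
have -> : level x s = (level x s).-1.+1 by rewrite prednK // up_log_gt0.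
by rewrite expnS -mulnA leq_mul2l.
Qed.

Lemma pow9 (l : nat) : (9 ^ l)%:R = (3 ^ l)%:R ^+ 2 :> R.
Proof. by rewrite -natrX -expnM mulnC expnM. Qed.

Lemma level_ge_sqrt (x s : nat) : (0 < s)%N ->
  Num.sqrt x%:R <= (3 ^ level x s)%:R * Num.sqrt s%:R :> R.
Proof.
move=> s0; rewrite -ler_sqr ?nnegrE ?mulr_ge0 ?sqrtr_ge0 //.
rewrite exprMn !sqr_sqrtr // -pow9 -natrM ler_nat.
exact: level_ge.
Qed.

Lemma level_le_sqrt (x s : nat) : (0 < s <= x)%N ->
  (3 ^ level x s)%:R * Num.sqrt s%:R <= 3 * Num.sqrt x%:R :> R.
Proof.
move=> sx; rewrite -ler_sqr ?nnegrE ?mulr_ge0 ?sqrtr_ge0 // !exprMn !sqr_sqrtr // -pow9.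
by rewrite -natrX -!natrM ler_nat level_le.
Qed.

Lemma sqrt_nat4 (d : nat) : Num.sqrt (4 * d)%:R = 2 * Num.sqrt d%:R :> R.
Proof. by rewrite natrM sqrtrM // (natrX _ 2 2) sqrtr_sqr ger0_norm. Qed.

(* A pair (rho, k): [k] rounds started with probability [rho] on each item.
   With exactly [s] solutions the initial angle is [pi / (2 m)], so that m-fold
   rotation ends at [pi / 2]. *)
Definition exact_run (d s : nat) : R * nat :=
  let m := (3 ^ level (4 * d) s)%N in (sin (pi / (2 * m%:R)) ^+ 2 / s%:R, m./2).

Definition uniform_runs (d T : nat) : seq (R * nat) :=
  [seq (d%:R^-1, (3 ^ l)./2) | l <- iota 0 (level d T).+1].

Definition search_plan (d T : nat) : seq (R * nat) :=
  [seq exact_run d s | s <- iota 1 (minn T d)] ++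
  (if (T < d)%N then flatten (nseq T (uniform_runs d T)) else [::]).

(** The factor 4 in [exact_run] serves this bound: it gives [m >= 2 * sqrt (d / s)], while [sin (pi
    / (2 * m)) <= pi / (2 * m) <= 2 / m]. Hence [d] items of this weight fit into total probability
    1. *)
Lemma exact_run_valid (d s : nat) : (0 < s <= d)%N -> 0 <= (exact_run d s).1 <= d%:R^-1.
Proof.
move=> /andP[s0 sd]; have d0 : (0 < d)%N by exact: leq_trans sd.
rewrite /= divr_ge0 ?sqr_ge0 //= ler_pdivrMr ?ltr0n // [leRHS]mulrC ler_pdivlMr ?ltr0n //.
set m := (3 ^ _)%:R; have m0 : 0 < m :> R by rewrite ltr0n expn_gt0.
have := level_ge_sqrt (4 * d) s0; rewrite -/m => h.
have a0 : 0 <= pi / (2 * m) :> R by rewrite divr_ge0 ?pi_ge0 // mulr_ge0 // ltW.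
have a1 : pi / (2 * m) <= 2 / m :> R.
  rewrite invfM mulrA ler_pM2r ?invr_gt0 //; exact: ltW (pihalf_lt2 R).
have a2 : pi / (2 * m) <= pi :> R.
  rewrite ler_pdivrMr ?mulr_gt0 // ler_peMr ?pi_ge0 //.
  have : 1 <= m by rewrite ler1n expn_gt0.
  by lra.
have b0 : 0 <= sin (pi / (2 * m)) by apply: sin_ge0_pi; rewrite a0.
have b1 : sin (pi / (2 * m)) <= 2 / m := le_trans (sin_le_id a0) a1.
have -> : s%:R = Num.sqrt s%:R ^+ 2 :> R by rewrite sqr_sqrtr.
have -> : d%:R = Num.sqrt d%:R ^+ 2 :> R by rewrite sqr_sqrtr.
rewrite -exprMn ler_sqr ?nnegrE ?mulr_ge0 ?sqrtr_ge0 //.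
apply: (le_trans (ler_wpM2r (sqrtr_ge0 _) b1)).
by rewrite mulrAC ler_pdivrMr // [leRHS]mulrC -sqrt_nat4.
Qed.

Lemma search_plan_valid (d T : nat) (x : R * nat) : (0 < d)%N ->
  x \in search_plan d T -> 0 <= x.1 <= d%:R^-1.
Proof.
move=> d0; rewrite mem_cat => /orP[/mapP[s]|].
  rewrite mem_iota => /andP[s0]; rewrite add1n ltnS leq_min => /andP[_ sd] ->.
  by apply: exact_run_valid; rewrite s0.
case: ifP => // _ /flattenP[r] /nseqP[-> _] /mapP[l _ ->] /=.
by rewrite invr_ge0 ler0n lexx.
Qed.

Definition plan_cost (ps : seq (R * nat)) : nat := \sum_(x <- ps) (2 * x.2 + 1).

(** A run costs at most [6 * sqrt (d / s)], and the sum of [1 / sqrt s] over [s <= M] is at most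
    [2 * sqrt M]. *)
Lemma exact_runs_cost (d M : nat) : (M <= d)%N ->
  (plan_cost [seq exact_run d s | s <- iota 1 M])%:R <=
  12 * Num.sqrt d%:R * Num.sqrt M%:R :> R.
Proof.
rewrite /plan_cost; elim: M => [|M IH] Md.
  by rewrite big_nil !mulr_ge0 ?sqrtr_ge0.
rewrite -[X in iota _ X]addn1 iotaD map_cat big_cat /= big_seq1 /= half_pow3 add1n natrD.
apply: (le_trans (lerD (IH (ltnW Md)) (lexx _))).
set X := (3 ^ _)%:R; set b := Num.sqrt M.+1%:R; set a := Num.sqrt M%:R.
have hX : X * b <= 6 * Num.sqrt d%:R.
  apply: (le_trans (level_le_sqrt _)).
    by rewrite /= (leq_trans Md) // leq_pmull.
  by rewrite sqrt_nat4 mulrA -natrM.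
have b0 : 0 < b by rewrite sqrtr_gt0.
have a0 : 0 <= a by exact: sqrtr_ge0.
have d0 : 0 <= Num.sqrt d%:R :> R by exact: sqrtr_ge0.
have ab : b ^+ 2 = a ^+ 2 + 1 by rewrite !sqr_sqrtr // -natr1.
rewrite -(ler_pM2r b0) mulrDl.
move: (Num.sqrt d%:R) d0 hX => D D0 hX.
have e : D * b ^+ 2 = D * a ^+ 2 + D by rewrite ab; ring.
(* With [b ^+ 2 = a ^+ 2 + 1] this says [1 <= 2 * b * (b - a)], up to the factor [D]: the new term
   is at most the growth of the right-hand side. *)
have : 0 <= D * (b - a) ^+ 2 by rewrite mulr_ge0 ?sqr_ge0.
by nra.
Qed.

Lemma sum_pow3 (L : nat) : (2 * \sum_(l <- iota 0 L.+1) 3 ^ l <= 3 * 3 ^ L)%N.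
Proof.
elim: L => [|L IH]; first by rewrite big_seq1.
rewrite -[X in iota _ X]addn1 iotaD big_cat /= big_seq1 add0n mulnDr expnS.
by move: (\sum_(_ <- _) _)%N (3 ^ L)%N IH => u v; lia.
Qed.

Lemma plan_cost_cat (ps ps' : seq (R * nat)) :
  plan_cost (ps ++ ps') = (plan_cost ps + plan_cost ps')%N.
Proof. by rewrite /plan_cost big_cat. Qed.

Lemma plan_cost_nseq (k : nat) (ps : seq (R * nat)) :
  plan_cost (flatten (nseq k ps)) = (k * plan_cost ps)%N.
Proof.
elim: k => [|k IH]; first by rewrite /plan_cost big_nil.
by rewrite /= plan_cost_cat IH mulSn.
Qed.

Lemma uniform_runs_cost (d T : nat) : (0 < T <= d)%N ->
  (plan_cost (flatten (nseq T (uniform_runs d T))))%:R <=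
  9 / 2 * (Num.sqrt d%:R * Num.sqrt T%:R) :> R.
Proof.
move=> Td; set ps := uniform_runs _ _.
rewrite plan_cost_nseq.
have : (2 * plan_cost ps <= 3 * 3 ^ level d T)%N.
  rewrite /plan_cost big_map /=; under eq_bigr do rewrite half_pow3.
  exact: sum_pow3.
have := level_le_sqrt Td; have T0 : 0 <= Num.sqrt T%:R :> R by exact: sqrtr_ge0.
rewrite -(ler_nat R) !natrM; have -> : T%:R = Num.sqrt T%:R ^+ 2 :> R by rewrite sqr_sqrtr.
rewrite sqrtr_sqr ger0_norm //.
have c0 : 0 <= (plan_cost ps)%:R :> R by [].
move: (Num.sqrt T%:R) (Num.sqrt d%:R) (_ ^ _)%:R (plan_cost ps)%:R T0 c0.
by move=> t D X c t0 c0 h1 h2; nra.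
Qed.

(** The two phases contribute 12 and 9/2; 17 rounds their sum up. *)
Lemma search_plan_cost (d T : nat) : (0 < T)%N ->
  (plan_cost (search_plan d T))%:R <= 17 * (Num.sqrt d%:R * Num.sqrt T%:R) :> R.
Proof.
move=> T0; rewrite /search_plan plan_cost_cat natrD.
have h1 := exact_runs_cost (geq_minr T d).
have h2 : Num.sqrt (minn T d)%:R <= Num.sqrt T%:R :> R by rewrite ler_sqrt // ler_nat geq_minl.
have h3 : 0 <= Num.sqrt d%:R :> R by exact: sqrtr_ge0.
have h4 : 0 <= Num.sqrt T%:R :> R by exact: sqrtr_ge0.
have h5 : (plan_cost (if (T < d)%N then flatten (nseq T (uniform_runs d T)) else [::]))%:R
    <= 9 / 2 * (Num.sqrt d%:R * Num.sqrt T%:R) :> R.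
  case: ifP => [Td|_]; first by apply: uniform_runs_cost; rewrite T0 ltnW.
  by rewrite /plan_cost big_nil !mulr_ge0 ?sqrtr_ge0 // invr_ge0.
apply: (le_trans (lerD h1 h5)).
move: (Num.sqrt d%:R) (Num.sqrt T%:R) (Num.sqrt _) h2 h3 h4 => D t u h2 h3 h4.
by nra.
Qed.

Definition plan_fail (t : nat) (ps : seq (R * nat)) : R :=
  \prod_(x <- ps) cos (amp_angle x.2 (t%:R * x.1)) ^+ 2.

Lemma plan_fail_itv (t : nat) (ps : seq (R * nat)) : 0 <= plan_fail t ps <= 1.
Proof.
rewrite /plan_fail; elim: ps => [|x ps /andP[h0 h1]]; first by rewrite big_nil ler01 lexx.
by rewrite big_cons mulr_ge0 ?sqr_ge0 //= mulr_ile1 ?sqr_ge0 ?cos2_le1.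
Qed.

(** The angle is 0, so no run reports a solution where there is none: the error of a search is
    one-sided. *)
Lemma plan_fail0 (ps : seq (R * nat)) : plan_fail 0 ps = 1.
Proof.
rewrite /plan_fail big1_seq // => x _; rewrite /amp_angle mul0r sqrtr0.
rewrite -{1}sin0 sinK ?mulr0 ?cos0 ?expr1n //.
by rewrite in_itv /= oppr_le0 andbb divr_ge0 ?pi_ge0.
Qed.

Lemma plan_fail_mem (t : nat) (ps : seq (R * nat)) (x : R * nat) : x \in ps ->
  plan_fail t ps <= cos (amp_angle x.2 (t%:R * x.1)) ^+ 2.
Proof.
elim: ps => // y ps IH; rewrite inE /plan_fail big_cons.
have /andP[h0 h1] := plan_fail_itv t ps.
case: eqP => [-> _|_ /= /IH h]; first by rewrite ler_piMr ?sqr_ge0.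
by apply: le_trans h; rewrite ler_piMl ?cos2_le1.
Qed.

Lemma exact_run_fail (d s : nat) : (0 < s)%N ->
  cos (amp_angle (exact_run d s).2 (s%:R * (exact_run d s).1)) ^+ 2 = 0.
Proof.
move=> s0; rewrite /exact_run /amp_angle /= half_pow3; set m := (3 ^ _)%N.
have m0 : 0 < m%:R :> R by rewrite ltr0n expn_gt0.
have m1 : 1 <= m%:R :> R by rewrite ler1n expn_gt0.
rewrite mulrCA divff ?mulr1; last by rewrite pnatr_eq0 -lt0n.
have a0 : 0 <= pi / (2 * m%:R) :> R by rewrite divr_ge0 ?pi_ge0 ?mulr_ge0.
have a2 : pi / (2 * m%:R) <= pi / 2 :> R.
  by rewrite invfM mulrA ler_pdivrMr // ler_peMr // divr_ge0 ?pi_ge0.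
have b0 : 0 <= sin (pi / (2 * m%:R)) :> R.
  apply: sin_ge0_pi; rewrite a0 (le_trans a2) // ler_pdivrMr //.
  by have := pi_ge0 R; lra.
rewrite sqrtr_sqr ger0_norm // sinK; last first.
  by rewrite in_itv /= a2 (le_trans _ a0) // oppr_le0 divr_ge0 ?pi_ge0.
have -> : m%:R * (pi / (2 * m%:R)) = pi / 2 :> R by field; rewrite gt_eqF.
by rewrite cos_pihalf expr0n.
Qed.

(** The endpoints of [[pi/4, 3 pi/4]] have ratio 3, so tripling an angle cannot jump over the
    interval. The last angle [3 ^ level d T * th] is at least 1, because [sqrt (t / d) <= th] and
    [T <= t], so the interval is reached within the list. *)
Lemma uniform_runs_fail (d T t : nat) : (0 < T <= t)%N -> (t <= d)%N ->
  plan_fail t (uniform_runs d T) <= 1 / 2.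
Proof.
move=> /andP[T0 Tt] td.
have d0 : (0 < d)%N by rewrite (leq_trans _ td) // (leq_trans T0).
have p0 : 0 < t%:R / d%:R :> R by rewrite divr_gt0 ?ltr0n // (leq_trans T0).
have p1 : t%:R / d%:R <= 1 :> R by rewrite ler_pdivrMr ?ltr0n // mul1r ler_nat.
set th := asin (Num.sqrt (t%:R / d%:R)) : R.
have sp1 : -1 <= Num.sqrt (t%:R / d%:R : R) <= 1.
  by rewrite (le_trans _ (sqrtr_ge0 _)) ?lerN10 //= -[leRHS]sqrtr1 ler_sqrt.
have sE : sin th = Num.sqrt (t%:R / d%:R) by rewrite asinK // in_itv.
have th1 : th <= pi / 2 by exact: asin_lepi2.
have th0 : 0 <= th.
  rewrite leNgt; apply/negP => h.
  have : 0 < sin (- th).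
    apply: sin_gt0_pihalf; rewrite oppr_gt0 h /= lt_neqAle lerNl asin_geNpi2 // andbT.
    apply/eqP => e; have := sqrtr_ge0 (t%:R / d%:R : R).
    rewrite -sE -[th]opprK e sinN sin_pihalf.
    by rewrite oppr_ge0 ler10.
  by rewrite sinN oppr_gt0 sE ltNge sqrtr_ge0.
have big : 1 <= (3 ^ level d T)%:R * th.
  apply: (@le_trans _ _ ((3 ^ level d T)%:R * Num.sqrt (t%:R / d%:R))); last first.
    by rewrite ler_wpM2l // -sE sin_le_id.
  have dd : 0 < Num.sqrt d%:R :> R by rewrite sqrtr_gt0 ltr0n.
  rewrite sqrtrM // sqrtrV // mulrA ler_pdivlMr // mul1r.
  apply: (le_trans (level_ge_sqrt d T0)); rewrite ler_wpM2l //.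
  by rewrite ler_sqrt // ler_nat.
have [l ll h] : exists2 l, (l <= level d T)%N & pi / 4 <= (3 ^ l)%:R * th <= 3 * pi / 4.
  have ex : exists l, pi / 4 <= (3 ^ l)%:R * th.
    by exists (level d T); apply: le_trans big; have := pihalf_lt2 R; lra.
  case: (ex_minnP ex) => l hl min; exists l.
    by apply: min; apply: le_trans big; have := pihalf_lt2 R; lra.
  (* For [l = 0] the upper end follows from [th <= pi / 2]; otherwise minimality puts the previous
     angle below [pi / 4]. *)
  rewrite hl /=; case: l hl min => [|l] hl min.
    by rewrite mul1r; have := pi_ge0 R; lra.
  have : (3 ^ l)%:R * th < pi / 4.
    by rewrite ltNge; apply/negP => /min; rewrite ltnn.
  by rewrite expnS natrM; lra.
apply: (le_trans (@plan_fail_mem t _ (d%:R^-1, (3 ^ l)./2) _)).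
  by apply/mapP; exists l => //; rewrite mem_iota ltnS.
by rewrite /amp_angle /= half_pow3; exact: cos2_le_half.
Qed.

Lemma plan_fail_cat (t : nat) (ps ps' : seq (R * nat)) :
  plan_fail t (ps ++ ps') = plan_fail t ps * plan_fail t ps'.
Proof. by rewrite /plan_fail big_cat. Qed.

Lemma plan_fail_nseq (t k : nat) (ps : seq (R * nat)) :
  plan_fail t (flatten (nseq k ps)) = plan_fail t ps ^+ k.
Proof.
elim: k => [|k IH]; first by rewrite /plan_fail big_nil.
by rewrite /= plan_fail_cat IH exprS.
Qed.

Lemma search_plan_fail (d T t : nat) : (0 < T)%N -> (0 < t <= d)%N ->
  plan_fail t (search_plan d T) <= (1 / 2) ^+ T.
Proof.
move=> T0 /andP[t0 td]; have [tT|Tt] := leqP t T.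
  apply: (@le_trans _ _ 0); last by rewrite exprn_ge0 // divr_ge0.
  rewrite -(exact_run_fail d t0); apply: plan_fail_mem.
  by rewrite mem_cat map_f // mem_iota t0 add1n ltnS leq_min tT td.
rewrite /search_plan (leq_trans Tt td) plan_fail_cat.
have /andP[h0 h1] := plan_fail_itv t [seq exact_run d s | s <- iota 1 (minn T d)].
have /andP[g0 _] := plan_fail_itv t (flatten (nseq T (uniform_runs d T))).
apply: (le_trans (ler_piMl g0 h1)).
have u : plan_fail t (uniform_runs d T) <= 1 / 2.
  by apply: uniform_runs_fail => //; rewrite T0 ltnW.
have /andP[u0 _] := plan_fail_itv t (uniform_runs d T).
by rewrite plan_fail_nseq lerXn2r ?nnegrE ?divr_ge0.
Qed.

End SearchPlan.

(** * Small-error search *)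

Section Search.
Variables (R : realType) (Q : finType) (A : finZmodType) (n : nat) (X : finType).
Variables (q0 : Q) (x0 : X).
Local Notation W := (option 'I_n * X)%type.
Local Notation B := (basis Q A W).
Local Notation circuit := (circuit Q A W).
Local Notation tree := (tree R Q A W).

(* [None] is a dummy item that is never good; the amplitude it absorbs makes the
   rotation angle of an exact run adjustable. *)
Definition clean (o : option 'I_n) : B := (q0, 0, (o, x0)).

Definition item_amp (d : nat) (rho : R) (o : option 'I_n) : R :=
  if o is Some p then (if (p < d)%N then Num.sqrt rho else 0)
  else Num.sqrt (1 - d%:R * rho).

Definition valid_weight (d : nat) (rho : R) : bool :=
  [&& (d <= n)%N, 0 <= rho & d%:R * rho <= 1].

(** An invalid weight is replaced by 0, which leaves all amplitude on the dummy. Every [d] and [rho]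
    then give a unit vector, as a tree must also cover answers [d] that no instance produces. *)
Definition start_fun (d : nat) (rho : R) (b : B) : R :=
  if b == clean b.2.1 then item_amp d (if valid_weight d rho then rho else 0) b.2.1
  else 0.

Lemma big_option (F : option 'I_n -> R) :
  \sum_o F o = F None + \sum_p F (Some p).
Proof.
rewrite (bigD1 None) //=; congr (_ + _).
rewrite (reindex_omap (@Some 'I_n) id) => [|[p|]] //.
by apply: eq_bigl => p /=; rewrite eqxx.
Qed.

Lemma sum_start_fun (d : nat) (rho : R) (m : pred B) :
  \sum_(b | m b) start_fun d rho b ^+ 2 =
  \sum_(o | m (clean o)) item_amp d (if valid_weight d rho then rho else 0) o ^+ 2.
Proof.
rewrite big_mkcond [RHS]big_mkcond (partition_big (fun b : B => b.2.1) predT) //=.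
apply: eq_bigr => o _; rewrite (bigD1 (clean o)) //= /start_fun eqxx.
rewrite big1 ?addr0 // => b /andP[/eqP -> /negbTE ->].
by rewrite expr0n; case: ifP.
Qed.

Lemma card_ord_lt (d : nat) : (d <= n)%N -> #|[set p : 'I_n | (p < d)%N]| = d.
Proof.
move=> dn; rewrite -sum1dep_card -(big_ord_widen n (fun=> 1%N) dn).
by rewrite sum1_card card_ord.
Qed.

Lemma start_fun_unit (d : nat) (rho : R) : \sum_b start_fun d rho b ^+ 2 = 1.
Proof.
rewrite sum_start_fun big_option /=; set r := if _ then _ else _.
have sumE : \sum_(p < n) (if (p < d)%N then Num.sqrt r else 0) ^+ 2 = d%:R * r.
  rewrite /r; case: ifP => [/and3P[dn r0 _]|_]; last first.
    rewrite mulr0 big1 // => p _; rewrite sqrtr0 if_same expr0n //.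
  rewrite -[in RHS](card_ord_lt dn) mulr_natl -sumr_const [RHS]big_mkcond /=.
  apply: eq_bigr => p _; rewrite inE.
  by case: ifP => _; rewrite ?sqr_sqrtr ?expr0n.
rewrite sumE sqr_sqrtr ?subrK // subr_ge0 /r.
by case: ifP => [/and3P[]|_] //; rewrite mulr0 ler01.
Qed.

Definition start (d : nat) (rho : R) : unit_vector R Q A W :=
  UnitVector (start_fun_unit d rho).

Fixpoint try_all (d : nat) (E : circuit) (m : pred B) (ps : seq (R * nat))
    (c : bool -> tree) : tree :=
  if ps is x :: ps' then
    Amp (start d x.1) x.2 E m
      (fun found => if found then c true else try_all d E m ps' c)
  else c false.

Variable f : Q -> A.

Definition solutions (d : nat) (E : circuit) (m : pred B) : {set 'I_n} :=
  [set p : 'I_n | (p < d)%N && m (circuit_perm f E (clean (Some p)))].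

Lemma good_weight_start (d : nat) (rho : R) (E : circuit) (m : pred B) :
  valid_weight d rho -> ~~ m (circuit_perm f E (clean None)) ->
  good_weight f (start d rho) E m = #|solutions d E m|%:R * rho.
Proof.
move=> v /negbTE mN; rewrite /good_weight sum_start_fun v.
rewrite big_mkcond big_option mN add0r mulr_natl -sumr_const [RHS]big_mkcond /=.
apply: eq_bigr => p _; rewrite inE /=; case: ifP => _; rewrite ?andbF // andbT.
by case: ifP => _; rewrite ?expr0n // sqr_sqrtr //; case/and3P: v.
Qed.

Lemma try_all_prob (d : nat) (E : circuit) (m : pred B) (ps : seq (R * nat))
    (c : bool -> tree) (b : bool) :
  ~~ m (circuit_perm f E (clean None)) ->
  (forall x, x \in ps -> valid_weight d x.1) ->
  let F := plan_fail #|solutions d E m| ps in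
  tree_prob f (try_all d E m ps c) b =
  (1 - F) * tree_prob f (c true) b + F * tree_prob f (c false) b.
Proof.
move=> mN; elim: ps => [|x ps IH] valid /=.
  by rewrite /plan_fail big_nil subrr mul0r add0r mul1r.
rewrite good_weight_start ?valid ?mem_head // IH => [|y yps]; last first.
  by apply: valid; rewrite inE yps orbT.
rewrite /plan_fail big_cons; set a := amp_angle _ _.
have -> : sin a ^+ 2 = 1 - cos a ^+ 2 by rewrite cos2sin2; ring.
ring.
Qed.

Lemma try_all_queries (d : nat) (E : circuit) (m : pred B) (ps : seq (R * nat))
    (c : bool -> tree) (q : nat) : (forall b, tree_queries f (c b) <= q)%N ->
  (tree_queries f (try_all d E m ps c) <= plan_cost ps * circuit_queries E + q)%N.
Proof.
move=> cq; elim: ps => [|x ps IH] /=; first exact: leq_trans (cq _) (leq_addl _ _).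
rewrite /plan_cost big_cons [X in (_ <= X + _)%N]mulnDl -addnA leq_add2l geq_max.
by rewrite (leq_trans (cq _) (leq_addl _ _)).
Qed.

End Search.

Lemma tree_prob_itv (R : realType) (Q : finType) (A : finZmodType) (W : finType)
    (f : Q -> A) (t : tree R Q A W) (b : bool) : 0 <= tree_prob f t b <= 1.
Proof.
elim: t => [b'|q k IH|s k E m t IH] //=; first by case: eqP; rewrite ?lexx ?ler01.
case/andP: (IH true) => a0 a1; case/andP: (IH false) => c0 c1.
apply/andP; split.
  by apply: addr_ge0; apply: mulr_ge0 => //; exact: sqr_ge0.
rewrite cos2sin2; set z := sin _ ^+ 2.
have z0 : 0 <= z by exact: sqr_ge0.
have z1 : z <= 1 by rewrite -subr_ge0 -cos2sin2 sqr_ge0.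
apply: (@le_trans _ _ (z * 1 + (1 - z) * 1)); last by rewrite !mulr1 subrKC.
by rewrite lerD // ler_wpM2l // subr_ge0.
Qed.

(** * Reversible lookup by four dependent queries *)

Section AdaptiveCircuit.
Variables (Q : finType) (A : finZmodType) (I : finType) (q0 : Q) (f : Q -> A).
Local Notation QA := (Q * A)%type.
Local Notation W := (I * (QA * QA * QA))%type.
Local Notation B := (basis Q A W).

(** Overwriting the register with [g w] is not reversible; the transposition is, and it writes [g w]
    whenever the register holds [q0]. *)
Definition set_query (g : W -> Q) (b : B) : B :=
  let: (q, a, w) := b in (tperm q0 (g w) q, a, w).

Lemma set_query_inj (g : W -> Q) : injective (set_query g).
Proof. by apply: inv_inj => -[[q a] w]; rewrite /set_query tpermK. Qed.

(** The last query and its answer are stored, and the oldest slot is fetched in exchange. While that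
    slot is blank, the next query starts clean; three slots suffice for four queries. *)
Definition rotate (b : B) : B :=
  let: (q, a, (o, (x1, x2, x3))) := b in (x3.1, x3.2, (o, ((q, a), x1, x2))).

Lemma rotate_inj : injective rotate.
Proof.
apply: (can_inj (g := fun b : B =>
  let: (q, a, (o, (x1, x2, x3))) := b in (x1.1, x1.2, (o, (x2, x3, (q, a)))))).
by move=> [[q a] [o [[[q1 a1] [q2 a2]] [q3 a3]]]].
Qed.

Definition adaptive_circuit (g1 g2 g3 g4 : W -> Q) : circuit Q A W :=
  let set g := Some (perm (@set_query_inj g)) in
  let rot := Some (perm rotate_inj) in
  [:: set g1; None; rot; set g2; None; rot; set g3; None; rot; set g4; None].

Definition blank : QA * QA * QA := ((q0, 0), (q0, 0), (q0, 0)).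

Lemma adaptive_circuitE (g1 g2 g3 g4 : W -> Q) (o : I) :
  let q1 := g1 (o, blank) in let h1 := (q1, f q1) in
  let q2 := g2 (o, (h1, (q0, 0), (q0, 0))) in let h2 := (q2, f q2) in
  let q3 := g3 (o, (h2, h1, (q0, 0))) in let h3 := (q3, f q3) in
  let q4 := g4 (o, (h3, h2, h1)) in
  circuit_perm f (adaptive_circuit g1 g2 g3 g4) (q0, 0, (o, blank)) =
  (q4, f q4, (o, (h3, h2, h1))).
Proof.
move=> q1 h1 q2 h2 q3 h3 q4.
have stepE g E w : circuit_perm f (Some (perm (@set_query_inj g)) :: None :: E) (q0, 0, w) =
    circuit_perm f E (g w, f (g w), w).
  by rewrite /= !permM !permE /set_query tpermL /query_fun add0r.
have rotE E b : circuit_perm f (Some (perm rotate_inj) :: E) b = circuit_perm f E (rotate b).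
  by rewrite /= permM permE.
apply: (etrans (stepE g1 _ _)); apply: (etrans (rotE _ _)).
apply: (etrans (stepE g2 _ _)); apply: (etrans (rotE _ _)).
apply: (etrans (stepE g3 _ _)); apply: (etrans (rotE _ _)).
by apply: (etrans (stepE g4 _ _)); rewrite /= perm1.
Qed.

End AdaptiveCircuit.

(** * Evaluation of a DAG *)

Section DagEvaluation.
Variables (R : realType) (n K : nat).
Local Notation Q := (query n K).
Local Notation A := (answer n K).
Local Notation W := (option 'I_n * ((Q * A) * (Q * A) * (Q * A)))%type.
Local Notation B := (basis Q A W).
Local Notation tree := (tree R Q A W).

Definition ask_nbr (i : 'I_n) (w : W) : Q :=
  if w.1 is Some p then QNbr i p else QRoot.

(** Each rotation moves the neighbour query one slot further, so its answer is read here from slot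
    1, and in the next two definitions from slots 2 and 3. [QRoot] is a filler where nothing is to
    be asked. *)
Definition ask_sgn (i : 'I_n) (w : W) : Q :=
  if insub (val w.2.1.1.2) is Some j then QSgn i j else QRoot.

Definition ask_var (nh : nat) (w : W) : Q :=
  if (nh <= w.2.1.2.2)%N then
    if insub (val w.2.1.2.2) is Some j then QVar j else QRoot
  else QRoot.

Definition ask_val (nh : nat) (w : W) : Q :=
  if (nh <= w.2.2.2)%N then
    if insub (val w.2.1.1.2) is Some k then QVal k else QRoot
  else QRoot.

Definition input_circuit (nh : nat) (i : 'I_n) : circuit Q A W :=
  adaptive_circuit QRoot (ask_nbr i) (ask_sgn i) (ask_var nh) (ask_val nh).

(** For an input below [nh] the value comes from the classical record [v]; the last answer of the
    circuit counts only for sinks. [isSome o] keeps the dummy unmarked. *)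
Definition input_marked (nh : nat) (v : nat -> bool) (target : bool) (b : B) : bool :=
  let: (_, a, (o, (_, h2, h1))) := b in
  isSome o &&
  (literal (if (h1.2 < nh)%N then v h1.2 else val a == 1%N) (val h2.2 == 1%N) == target).

Fixpoint eval_vertices (nh T : nat) (l : seq ('I_n * nat)) (v : nat -> bool)
    (c : (nat -> bool) -> tree) : tree :=
  if l is (i, d) :: l' then
    Ask (QGate i) (fun h : A =>
      try_all QRoot (blank A QRoot) d (input_circuit nh i)
        (input_marked nh v (val h == 2%N)) (search_plan R d T)
        (fun found => eval_vertices nh T l'
           (fun j => if j == i then found (+) (val h == 1%N) else v j) c))
  else c v.

(** The algorithm is not told [nhat]. As sinks come last, asking degrees until the first 0 reveals
    it, and the accumulator ends up in reverse topological order. *)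
Fixpoint probe_degrees (l : seq 'I_n) (acc : seq ('I_n * nat))
    (c : seq ('I_n * nat) -> tree) : tree :=
  if l is i :: l' then
    Ask (QDeg i) (fun d : A =>
      if val d == 0%N then c acc else probe_degrees l' ((i, val d) :: acc) c)
  else c acc.

(** For this [T], [nh ^ 2 <= 2 ^ T], so [nh] searches of error [1 / 2 ^ T] err with total
    probability at most [1 / nh]. *)
Definition repetitions (nh : nat) : nat := (2 * (trunc_log 2 nh).+1)%N.

Definition read_sink (r : nat) : tree :=
  if insub r is Some i then
    Ask (QVar i) (fun k : A =>
      if insub (val k) is Some k' then
        Ask (QVal k') (fun y : A => Leaf R Q A W (val y == 1%N))
      else Leaf R Q A W false)
  else Leaf R Q A W false.

Definition dag_tree : tree :=
  Ask QRoot (fun r : A => probe_degrees (enum 'I_n) [::] (fun l =>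
    if (r < size l)%N then
      eval_vertices (size l) (repetitions (size l)) l (fun=> false)
        (fun v => Leaf R Q A W (v r))
    else read_sink r)).

Definition dag_qalg : qalg R Q A :=
  @QAlg R Q A W (QRoot, 0, (None, blank A QRoot))
    (compile QRoot (None, blank A QRoot) dag_tree).

Variables (G : dag n K) (x : 'I_K -> bool).
Hypothesis wf : nand_and_or_not_dag G.
Let f : Q -> A := dag_oracle G x.

Lemma dag_adj_uniq (i : 'I_n) : uniq (dag_adj G i).
Proof. by case: wf => h _ _ _; exact: h. Qed.

Lemma dag_adj_size (i : 'I_n) : (size (dag_adj G i) <= n)%N.
Proof. by rewrite -[X in (_ <= X)%N]card_ord -(card_uniqP (dag_adj_uniq i)) max_card. Qed.

Lemma oracle_root : val (f QRoot) = dag_root G.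
Proof. by rewrite /f /dag_oracle /= inordK //; have := ltn_ord (dag_root G); lia. Qed.

Lemma oracle_deg (i : 'I_n) : val (f (QDeg i)) = size (dag_adj G i).
Proof. by rewrite /f /dag_oracle /= inordK //; have := dag_adj_size i; lia. Qed.

Lemma oracle_nbr (i p j0 : 'I_n) : (p < size (dag_adj G i))%N ->
  val (f (QNbr i p)) = nth j0 (dag_adj G i) p.
Proof.
move=> lt_p; rewrite /f /dag_oracle /= (nth_map j0) // inordK //.
by have := ltn_ord (nth j0 (dag_adj G i) p); lia.
Qed.

Lemma oracle_gate (i : 'I_n) : val (f (QGate i)) = gate_code (dag_gate G i).
Proof. by rewrite /f /dag_oracle /= inordK //; case: (dag_gate G i) => /=; lia. Qed.

Lemma oracle_sgn (i j : 'I_n) : val (f (QSgn i j)) = dag_sgn G i j.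
Proof. by rewrite /f /dag_oracle /= inordK //; case: (dag_sgn G i j) => /=; lia. Qed.

Lemma oracle_var (i : 'I_n) : val (f (QVar i)) = dag_var G i.
Proof. by rewrite /f /dag_oracle /= inordK //; have := ltn_ord (dag_var G i); lia. Qed.

Lemma oracle_val (k : 'I_K) : val (f (QVal k)) = x k.
Proof. by rewrite /f /dag_oracle /= inordK //; case: (x k) => /=; lia. Qed.

Lemma sinkE (i : 'I_n) : (i \in sinks G) = (nhat G <= i)%N.
Proof. by case: wf => _ _ h _. Qed.

Lemma input_markedE (i p : 'I_n) (v : nat -> bool) (target : bool) :
  (p < size (dag_adj G i))%N ->
  let j := nth i (dag_adj G i) p in
  ((j < nhat G)%N -> v j = value G x j) ->
  input_marked (nhat G) v target
    (circuit_perm f (input_circuit (nhat G) i) (clean A QRoot (blank A QRoot) (Some p))) =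
  (literal (value G x j) (dag_sgn G i j) == target).
Proof.
move=> lt_p j vj; rewrite /clean /input_circuit adaptive_circuitE /input_marked.
have jE : val (f (QNbr i p)) = j by exact: oracle_nbr.
rewrite [ask_nbr _ _]/= jE; set h1 := (QNbr i p, _).
have -> w w' : ask_sgn i (Some p, (h1, w, w')) = QSgn i j.
  by rewrite /ask_sgn /= jE valK.
rewrite oracle_sgn eqb1; congr (literal _ _ == _).
case: ltnP => [/vj //|sj]; rewrite /ask_val /= jE sj /ask_var /= jE sj valK.
by rewrite oracle_var valK oracle_val eqb1 value_sink // sinkE.
Qed.

(** Every gate asks for one deciding input: a true one for [OR] (code 2), a false one for [NAND] and
    [AND]. Only for [AND] (code 1) does finding it make the output false. *)
Lemma gate_evalE (h : gate) (ys : seq bool) :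
  gate_eval h ys = has (fun y => y == (gate_code h == 2%N)) ys (+) (gate_code h == 1%N).
Proof.
by case: h => /=; rewrite ?addbF ?addbT -?has_predC -?all_predC;
  [apply: eq_has|apply: eq_all|apply: eq_has] => -[].
Qed.

Lemma solutions_gt0 (i : 'I_n) (v : nat -> bool) (target : bool) :
  (forall j : 'I_n, (i < j < nhat G)%N -> v j = value G x j) ->
  (0 < #|solutions QRoot (blank A QRoot) f (size (dag_adj G i)) (input_circuit (nhat G) i)
           (input_marked (nhat G) v target)|)%N =
  has (fun y => y == target)
    [seq literal (value G x j) (dag_sgn G i j) | j <- dag_adj G i].
Proof.
move=> vj; have vnth (p : 'I_n) : (p < size (dag_adj G i))%N ->
    let j := nth i (dag_adj G i) p in (j < nhat G)%N -> v j = value G x j.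
  move=> lt_p j jn; apply: vj; rewrite jn andbT; case: wf => _ h _ _.
  by apply: h; rewrite inE mem_nth.
rewrite has_map; apply/card_gt0P/hasP => [[p]|[j jG /= vt]].
  rewrite inE => /andP[lt_p]; rewrite input_markedE //; last exact: vnth.
  by exists (nth i (dag_adj G i) p); rewrite ?mem_nth.
have lt_j : (index j (dag_adj G i) < size (dag_adj G i))%N by rewrite index_mem.
have lt_n := leq_trans lt_j (dag_adj_size i).
exists (Ordinal lt_n); rewrite inE lt_j input_markedE //=; last exact: (vnth (Ordinal lt_n)).
by rewrite nth_index.
Qed.

Lemma input_marked_dummy (i : 'I_n) (nh : nat) (v : nat -> bool) (target : bool) :
  ~~ input_marked nh v target
       (circuit_perm f (input_circuit nh i) (clean A QRoot (blank A QRoot) None)).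
Proof. by rewrite /clean /input_circuit adaptive_circuitE. Qed.

(** Invariant: [v] is right on the function-vertices no longer listed in [l]. Indices descend along
    [l], so the inputs of its head are settled, and a union bound charges [(1 / 2) ^+ T] per
    vertex. *)
Lemma eval_vertices_error (T : nat) (l : seq ('I_n * nat)) (v : nat -> bool)
    (c : (nat -> bool) -> tree) (b : bool) :
  (0 < T)%N -> sorted (fun e e' : 'I_n * nat => e'.1 < e.1)%N l ->
  (forall e, e \in l -> e.2 = size (dag_adj G e.1) /\ e.1 \notin sinks G) ->
  (forall j : 'I_n, (j < nhat G)%N -> j \notin map fst l -> v j = value G x j) ->
  (forall v' : nat -> bool, (forall j : 'I_n, (j < nhat G)%N -> v' j = value G x j) ->
     tree_prob f (c v') b = 0) ->
  tree_prob f (eval_vertices (nhat G) T l v c) b <= (size l)%:R * (1 / 2) ^+ T.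
Proof.
move=> T0; elim: l v => [|[i d] l IH] v srt lG vG cG.
  by rewrite /= cG ?mul0r // => j jn; apply: vG.
have [/= dE ns] := lG _ (mem_head _ _).
have tr : transitive (fun e e' : 'I_n * nat => e'.1 < e.1)%N.
  by move=> e1 e2 e3 h1 h2; exact: ltn_trans h2 h1.
have lt_l e : e \in l -> (e.1 < i)%N.
  by move=> el; move: srt; rewrite /= (path_sortedE tr) => /andP[/allP/(_ e el)].
have d0 : (0 < d)%N by rewrite dE lt0n; move: ns; rewrite inE.
rewrite /= try_all_prob ?input_marked_dummy //; last first.
  move=> y /(search_plan_valid d0)/andP[y0 y1].
  rewrite /valid_weight y0 dE dag_adj_size -dE /=.
  by rewrite mulrC -ler_pdivlMr ?mul1r // ltr0n.
set m := input_marked _ _ _; set S := solutions _ _ _ _ _ _.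
have SE : (0 < #|S|)%N = value G x i (+) (gate_code (dag_gate G i) == 1%N).
  rewrite /S /m dE oracle_gate solutions_gt0 => [|j /andP[ij jn]].
    by rewrite value_gate // gate_evalE -addbA addbb addbF.
  apply: vG => //; rewrite inE negb_or /=; apply/andP; split.
    by apply: contraTneq ij => ->; rewrite ltnn.
  by apply/mapP => -[e /lt_l ei ej]; move: ij; rewrite ej ltnNge (ltnW ei).
have step fd : fd = (0 < #|S|)%N ->
    tree_prob f (eval_vertices (nhat G) T l (fun j => if j == i then
      fd (+) (val (f (QGate i)) == 1%N) else v j) c) b <= (size l)%:R * (1 / 2) ^+ T.
  move=> ->; apply: IH => //; first exact: path_sorted srt.
    by move=> e el; apply: lG; rewrite inE el orbT.
  move=> j jn jl; case: eqP => [/val_inj ->|/eqP ji].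
    by rewrite SE oracle_gate -addbA addbb addbF.
  by apply: vG => //; rewrite inE negb_or jl andbT.
have e0 : 0 <= (1 / 2) ^+ T :> R by rewrite exprn_ge0 // divr_ge0.
have /andP[F0 F1] := plan_fail_itv #|S| (search_plan R d T).
have [S0|S0] := posnP #|S|.
  (* Without a solution the search cannot err, and this vertex adds nothing. *)
  rewrite S0 plan_fail0 subrr mul0r add0r mul1r.
  by apply: (le_trans (step false _)); rewrite ?S0 // ler_wpM2r // ler_nat.
have ht := step true (esym S0).
have hF : plan_fail #|S| (search_plan R d T) <= (1 / 2) ^+ T.
  apply: search_plan_fail => //; rewrite S0 /=.
  have dn : (d <= n)%N by rewrite dE dag_adj_size.
  rewrite -[leqRHS](card_ord_lt dn); apply: subset_leq_card.
  by apply/fintype.subsetP => p; rewrite !inE => /andP[].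
move: ((1 / 2) ^+ T) e0 hF ht => e e0 hF ht; rewrite -natr1 [leRHS]mulrDl mul1r; apply: lerD.
  apply: le_trans ht; rewrite ler_piMl ?lerBlDr ?lerDl //.
  by case/andP: (tree_prob_itv f (eval_vertices (nhat G) T l (fun j => if j == i then
      true (+) (val (f (QGate i)) == 1%N) else v j) c) b).
apply: le_trans hF; rewrite ler_piMr //.
by case/andP: (tree_prob_itv f (eval_vertices (nhat G) T l (fun j => if j == i then
      false (+) (val (f (QGate i)) == 1%N) else v j) c) b).
Qed.

Lemma eval_vertices_queries (nh T : nat) (l : seq ('I_n * nat)) (v : nat -> bool)
    (c : (nat -> bool) -> tree) :
  (forall v', tree_queries f (c v') = 0%N) ->
  (tree_queries f (eval_vertices nh T l v c) <=
   \sum_(e <- l) (plan_cost (search_plan R e.2 T) * 4 + 1))%N.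
Proof.
move=> c0; elim: l v => [|[i d] l IH] v /=; first by rewrite c0.
rewrite big_cons /= addn1 addSn ltnS; apply: try_all_queries => fd; exact: IH.
Qed.

End DagEvaluation.

(** * Error probability and query count *)

(** Cauchy-Schwarz by induction: after the induction hypothesis, the squares of the two sides differ
    by a perfect square. *)
Lemma sum_sqrt_le (R : realType) (s : seq nat) :
  \sum_(d <- s) Num.sqrt d%:R <= Num.sqrt ((size s)%:R * (\sum_(d <- s) d)%:R) :> R.
Proof.
elim: s => [|d s IH]; first by rewrite !big_nil sqrtr_ge0.
rewrite !big_cons /=; apply: (le_trans (lerD (lexx _) IH)).
move: (size s) (\sum_(j <- s) j)%N => k D.
rewrite -ler_sqr ?nnegrE ?addr_ge0 ?sqrtr_ge0 // sqr_sqrtr ?mulr_ge0 // sqrtrM //.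
rewrite -natr1 natrD -(sqr_sqrtr (ler0n R d)) -(sqr_sqrtr (ler0n R k)).
rewrite -(sqr_sqrtr (ler0n R D)) !sqrtr_sqr !ger0_norm ?sqrtr_ge0 //.
move: (Num.sqrt d%:R) (Num.sqrt k%:R) (Num.sqrt D%:R) => a u w.
rewrite -subr_ge0 (_ : _ - _ = (w - u * a) ^+ 2) ?sqr_ge0 //; ring.
Qed.

Lemma find_iota (m n : nat) : (m <= n)%N -> find (leq m) (iota 0 n) = m.
Proof.
move=> mn; rewrite -(subnKC mn) iotaD find_cat add0n size_iota.
rewrite ifN => [|]; first by case: (n - m)%N => [|k]; rewrite /= ?leqnn addn0.
by apply/hasPn => k; rewrite mem_iota add0n -ltnNge.
Qed.

Section DagCorrectness.
Variables (R : realType) (n K : nat) (G : dag n K) (x : 'I_K -> bool).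
Hypothesis wf : nand_and_or_not_dag G.
Local Notation f := (dag_oracle G x).

Definition inner_vertices : seq 'I_n := take (nhat G) (enum 'I_n).

Definition inner_degrees : seq ('I_n * nat) :=
  rev [seq (i, size (dag_adj G i)) | i <- inner_vertices].

Lemma nhat_le : (nhat G <= n)%N. Proof. exact: leq_subr. Qed.

Lemma val_inner_vertices : map val inner_vertices = iota 0 (nhat G).
Proof. by rewrite map_take val_enum_ord take_iota (minn_idPl nhat_le). Qed.

Lemma mem_inner_vertices (i : 'I_n) : (i \in inner_vertices) = (i < nhat G)%N.
Proof. by rewrite -(mem_map val_inj) val_inner_vertices mem_iota. Qed.

Lemma size_inner_degrees : size inner_degrees = nhat G.
Proof.
by rewrite size_rev size_map -(size_map val) val_inner_vertices size_iota.
Qed.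

Lemma mem_inner_degrees (e : 'I_n * nat) : e \in inner_degrees ->
  e.2 = size (dag_adj G e.1) /\ e.1 \notin sinks G.
Proof.
rewrite mem_rev => /mapP[j]; rewrite mem_inner_vertices => lt_j -> /=.
by rewrite sinkE // -ltnNge.
Qed.

Lemma inner_degrees_sorted : sorted (fun e e' : 'I_n * nat => e'.1 < e.1)%N inner_degrees.
Proof.
rewrite rev_sorted sorted_map; have := iota_ltn_sorted 0 (nhat G).
by rewrite -val_inner_vertices sorted_map.
Qed.

Lemma inner_degrees_gt0 (d : nat) : d \in map snd inner_degrees -> (0 < d)%N.
Proof.
by move=> /mapP[e /mem_inner_degrees[-> ns] ->]; rewrite lt0n; move: ns; rewrite inE.
Qed.

Lemma sum_inner_degrees : (\sum_(e <- inner_degrees) e.2 <= #|edges G|)%N.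
Proof.
have -> : #|edges G| = (\sum_i size (dag_adj G i))%N.
  rewrite -sum1dep_card.
  rewrite -(pair_big_dep xpredT (fun i j => j \in dag_adj G i) (fun _ _ => 1%N)) /=.
  apply: eq_bigr => i _; rewrite sum1_card; apply/card_uniqP; exact: dag_adj_uniq.
rewrite (perm_big _ (permEl (perm_rev _))) big_map /= -big_enum /=.
by rewrite -[X in (_ <= \sum_(i <- X) _)%N](cat_take_drop (nhat G)) big_cat leq_addr.
Qed.

Lemma probe_degrees_prob (l : seq 'I_n) (acc : seq ('I_n * nat)) c (b : bool) :
  let k := find (fun i => i \in sinks G) l in
  let res := catrev [seq (i, size (dag_adj G i)) | i <- take k l] acc in
  tree_prob f (@probe_degrees R n K l acc c) b = tree_prob f (c res) b.
Proof.
elim: l acc => [|i l IH] acc //=.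
by rewrite oracle_deg // inE; case: ifP => // _; rewrite IH.
Qed.

Lemma probe_degrees_queries (l : seq 'I_n) (acc : seq ('I_n * nat)) c :
  let k := find (fun i => i \in sinks G) l in
  let res := catrev [seq (i, size (dag_adj G i)) | i <- take k l] acc in
  (tree_queries f (@probe_degrees R n K l acc c) <= k.+1 + tree_queries f (c res))%N.
Proof.
elim: l acc => [|i l IH] acc /=; first by rewrite leq_addl.
by rewrite oracle_deg // inE; case: ifP => // _; rewrite addSn ltnS; exact: IH.
Qed.

Lemma find_sink : find (fun i => i \in sinks G) (enum 'I_n) = nhat G.
Proof.
rewrite -[RHS](find_iota nhat_le) -val_enum_ord find_map.
by apply: eq_find => i; rewrite /= sinkE.
Qed.

Lemma dag_tree_error : (0 < nhat G)%N ->
  tree_prob f (dag_tree R n K) (~~ value G x (dag_root G)) <= 1 / (nhat G)%:R.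
Proof.
move=> nh0; rewrite /= probe_degrees_prob find_sink -/inner_degrees.
rewrite size_inner_degrees oracle_root; case: ltnP => [lt_r|ge_r]; last first.
  rewrite /read_sink valK /= oracle_var valK /= oracle_val eqb1.
  by rewrite value_sink ?sinkE //; case: (x _); rewrite divr_ge0.
set T := repetitions _; have T0 : (0 < T)%N by [].
apply: (le_trans (eval_vertices_error wf T0 inner_degrees_sorted _ _ _)) => //.
- exact: mem_inner_degrees.
- move=> j lt_j; rewrite map_rev mem_rev -map_comp map_id mem_inner_vertices lt_j //.
- by move=> v' v'E; rewrite /= v'E //; case: (value _ _ _).
rewrite size_inner_degrees expr_div_n expr1n mulrA mulr1 -natrX.
have nR : 0 < (nhat G)%:R :> R by rewrite ltr0n.
rewrite ler_pdivrMr ?ltr0n ?expn_gt0 // mulrAC ler_pdivlMr // mul1r -natrM ler_nat.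
rewrite mulnn /T /repetitions mulnC expnM leq_exp2r //.
exact: ltnW (trunc_log_ltn _ _).
Qed.

(** [N] is to be [nhat] for one claimed bound and [n] for the other. The constant is
    [74 = 6 + 4 * 17]: linear overhead, plus four queries per pass of the circuit. Every
    function-vertex has an out-edge, so [nhat <= m], which absorbs the linear part. *)
Lemma dag_tree_queries (N : nat) : (0 < nhat G)%N -> (nhat G <= N)%N -> (1 < N)%N ->
  (tree_queries f (dag_tree R n K))%:R <=
  74 * Num.sqrt (4 / ln 2) * Num.sqrt (N%:R * #|edges G|%:R * ln N%:R) :> R.
Proof.
move=> nh0 nhN N1; set T := repetitions (nhat G); have T0 : (0 < T)%N by [].
have h1 : (tree_queries f (dag_tree R n K) <=
    6 * nhat G + 4 * \sum_(e <- inner_degrees) plan_cost (search_plan R e.2 T))%N.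
  rewrite [tree_queries _ _]/=.
  apply: (leq_ltn_trans (probe_degrees_queries _ _ _)).
  rewrite find_sink -/inner_degrees size_inner_degrees oracle_root.
  case: (ltnP (dag_root G) (nhat G)) => _; last first.
    rewrite /read_sink valK /= oracle_var valK /=; lia.
  have := @eval_vertices_queries R n K G x (nhat G) T inner_degrees (fun=> false)
    (fun v => Leaf R _ _ _ (v (dag_root G))) (fun=> erefl).
  rewrite big_split /= -big_distrl /= sum1_size size_inner_degrees.
  rewrite [catrev _ _](erefl : _ = inner_degrees) -/T; move: (tree_queries _ _); lia.
have h2 : (\sum_(e <- inner_degrees) plan_cost (search_plan R e.2 T))%:R <=
    17 * Num.sqrt T%:R * Num.sqrt ((nhat G)%:R * #|edges G|%:R) :> R.
  apply: (@le_trans _ _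
    (17 * Num.sqrt T%:R * \sum_(d <- map snd inner_degrees) Num.sqrt d%:R)).
    rewrite natr_sum mulr_sumr big_map; apply: ler_sum => e _.
    by apply: (le_trans (search_plan_cost R e.2 T0)); rewrite -mulrA [_ * Num.sqrt T%:R]mulrC.
  rewrite ler_wpM2l ?mulr_ge0 ?sqrtr_ge0 //; apply: (le_trans (sum_sqrt_le _ _)).
  rewrite ler_sqrt ?mulr_ge0 // size_map size_inner_degrees ler_wpM2l //.
  by rewrite ler_nat big_map sum_inner_degrees.
have mn : (nhat G <= #|edges G|)%N.
  apply: leq_trans sum_inner_degrees; rewrite -size_inner_degrees -sum1_size.
  rewrite big_seq [X in (_ <= X)%N]big_seq; apply: leq_sum => e el.
  by apply: inner_degrees_gt0; apply: map_f.
have ln2 : 0 < ln 2 :> R by rewrite ln_gt0 // ltr1n.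
have N0 : 0 < N%:R :> R by rewrite ltr0n ltnW.
(* [T] is twice a rounded-down binary logarithm plus 2; since [2 <= N], the 2 is absorbed by
   doubling the factor. *)
have hT : T%:R <= 4 / ln 2 * ln N%:R :> R.
  rewrite mulrAC ler_pdivlMr // /T /repetitions natrM -[(trunc_log _ _).+1%:R]natr1.
  have l1 : ln 2 <= ln N%:R :> R by rewrite ler_ln ?posrE // ler_nat.
  have l2 : (trunc_log 2 (nhat G))%:R * ln 2 <= ln N%:R :> R.
    rewrite mulr_natl -lnXn // ler_ln ?posrE ?exprn_gt0 // -natrX ler_nat.
    exact: leq_trans (trunc_logP _ nh0) nhN.
  by move: (trunc_log _ _)%:R (ln 2) (ln N%:R) l1 l2 => t a b; nra.
have Z0 : 0 <= Num.sqrt ((nhat G)%:R * #|edges G|%:R) :> R by exact: sqrtr_ge0.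
have T1 : 1 <= Num.sqrt T%:R :> R by rewrite -[leLHS]sqrtr1 ler_sqrt // ler1n.
have h3 : (nhat G)%:R <= Num.sqrt ((nhat G)%:R * #|edges G|%:R) :> R.
  by rewrite -[leLHS]ger0_norm // -sqrtr_sqr ler_sqrt ?mulr_ge0 // expr2 ler_wpM2l // ler_nat.
have h4 : Num.sqrt T%:R * Num.sqrt ((nhat G)%:R * #|edges G|%:R) <=
    Num.sqrt (4 / ln 2) * Num.sqrt (N%:R * #|edges G|%:R * ln N%:R) :> R.
  have c0 : 0 <= 4 / ln 2 :> R by rewrite divr_ge0 // ltW.
  rewrite -!sqrtrM // ler_sqrt; last first.
    by rewrite !mulr_ge0 ?invr_ge0 ?ln_ge0 ?(ltW ln2) // ler1n ltnW.
  rewrite (_ : 4 / ln 2 * _ = 4 / ln 2 * ln N%:R * (N%:R * #|edges G|%:R)); last by ring.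
  by rewrite ler_pM ?mulr_ge0 // ler_wpM2r // ler_nat.
move: h1; rewrite -(ler_nat R) natrD !natrM => h1; apply: (le_trans h1).
rewrite -mulrA; move: h2 h3 h4 Z0 T1.
move: (Num.sqrt T%:R) (Num.sqrt ((nhat G)%:R * _)) (_ * Num.sqrt (N%:R * _ * _)).
by move=> t z y; nra.
Qed.

End DagCorrectness.

(** An edge out of the last vertex would need a larger index, so that vertex is a sink. With
    [0 < nhat] this gives [1 < n], hence a positive [ln n]. *)
Lemma nhat_lt (n K : nat) (G : dag n K) : nand_and_or_not_dag G -> (nhat G < n)%N.
Proof.
move=> wf; have n0 : (0 < n)%N by exact: leq_trans (ltn_ord (dag_root G)).
have lt_n : (n.-1 < n)%N by rewrite prednK.
suff : Ordinal lt_n \in sinks G by rewrite sinkE //= -ltnS prednK.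
rewrite inE size_eq0; case E: (dag_adj G _) => [//|j s].
have [_ edge_lt _ _] := wf; have := edge_lt (Ordinal lt_n) j.
by rewrite inE /= E mem_head => /(_ isT); have := ltn_ord j; lia.
Qed.

Lemma dag_qalg_evaluates (R : realType) :
  evaluates_within (fun n K => dag_qalg R n K) (@nand_and_or_not_dag)
    (74 * Num.sqrt (4 / ln 2)) 1.
Proof.
move=> n K G x wf nh0.
have startE : basis_state R (qstart (dag_qalg R n K)) =
    vec (fun b => 1 * ket R (QRoot, 0, (None, blank _ QRoot)) b).
  by rewrite vec_basis_state; apply: eq_vec => b; rewrite mul1r.
have time N : (nhat G <= N)%N -> (1 < N)%N ->
    running_time (fun n K => dag_qalg R n K) G x <=
    74 * Num.sqrt (4 / ln 2) * Num.sqrt (N%:R * #|edges G|%:R * ln N%:R).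
  move=> nhN N1; apply: le_trans (dag_tree_queries R x wf nh0 nhN N1).
  by rewrite ler_nat /num_queries startE; exact: compile_queries.
split; first exact: time.
  by apply: time; [exact: nhat_le|exact: leq_ltn_trans nh0 (nhat_lt wf)].
rewrite /error_prob /output_prob startE compile_prob expr1n mul1r.
exact: dag_tree_error.
Qed.

Theorem theorem2 (R : realType) :
  (exists (P : dag_algorithm R) (C c : R),
     evaluates_within P (@nand_and_or_not_dag) C c) /\
  (exists (P : dag_algorithm R) (C c : R),
     evaluates_within P (@nand_not_dag) C c).
Proof.
split; exists (fun n K => dag_qalg R n K), (74 * Num.sqrt (4 / ln 2)), 1.
  exact: dag_qalg_evaluates.
by move=> n K G x [wf _]; exact: dag_qalg_evaluates.
Qed.
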